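(* Let $(M,L)$ be a Finsler manifold admitting a concurrent $\pi$-vector field $\overline{\zeta}$, and let $(M,\widetilde{L})$ be the Finsler manifold obtained from it by the energy $\beta$-change $\widetilde{L}^{2}=L^{2}+B^{2}$, where $B:=g(\overline{\zeta},\overline{\eta})$. Put $p^{2}:=g(\overline{\zeta},\overline{\zeta})$. Then the associated Cartan connections $\nabla$ and $\widetilde{\nabla}$ are related, for all vector fields $X,Y$ on $\mathcal{T}M$, by $$\widetilde{\nabla}_{X}\rho Y=\nabla_{X}\rho Y-\frac{g(\rho X,\rho Y)}{1+p^{2}}\,\overline{\zeta}.$$ In particular, for all $\overline{X},\overline{Y}\in\mathfrak{X}(\pi(M))$: (a) $\widetilde{\nabla}_{\gamma\overline{X}}\overline{Y}=\nabla_{\gamma\overline{X}}\overline{Y}$; (b) $\widetilde{\nabla}_{\widetilde{\beta}\overline{X}}\overline{Y}=\nabla_{\beta\overline{X}}\overline{Y}-U(\overline{X},\overline{Y})$, where $U(\overline{X},\overline{Y})=\dfrac{g(\overline{X},\overline{Y})}{1+p^{2}}\,\overline{\zeta}-\dfrac{g(\overline{X},\overline{\eta})}{1+p^{2}}\,\nabla_{\gamma\overline{\zeta}}\overline{Y}$.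
   Context: $M$ is a real paracompact smooth manifold of finite dimension $n$; all objects are $C^\infty$. $\pi:\mathcal{T}M\to M$ is the bundle of nonzero tangent vectors, $\pi^{-1}(TM)\to\mathcal{T}M$ the pullback of $TM$ by $\pi$. Sections of $\pi^{-1}(TM)$ are called $\pi$-vector fields, are written with bars, and form the module $\mathfrak{X}(\pi(M))$. The fundamental $\pi$-vector field is $\overline{\eta}(u)=(u,u)$. $\rho:T(\mathcal{T}M)\to\pi^{-1}(TM)$ is $\rho=(\pi_{\mathcal{T}M},d\pi)$, and $\gamma:\pi^{-1}(TM)\to T(\mathcal{T}M)$ is the vertical lift $\gamma(u,v)=j_u(v)$, with $j_u:T_{\pi(u)}M\to T_u(T_{\pi(u)}M)$ the natural isomorphism. $(M,L)$ is a Finsler manifold with Finsler metric $g$ on $\pi^{-1}(TM)$ (locally $g_{ij}=\frac12\partial^2L^2/\partial y^i\partial y^j$). For a linear connection $D$ on $\pi^{-1}(TM)$ its connection map is $K(X)=D_X\overline{\eta}$; $D$ is regular if $T_u(\mathcal{T}M)=V_u(\mathcal{T}M)\oplus\ker K_u$ for all $u$ ($V$ the vertical bundle), and then its horizontal map is $\beta:=(\rho|_{\ker K})^{-1}$. With torsion $\mathbf{T}(X,Y)=D_X\rho Y-D_Y\rho X-\rho[X,Y]$, put $Q(\overline{X},\overline{Y})=\mathbf{T}(\beta\overline{X},\beta\overline{Y})$ and $T(\overline{X},\overline{Y})=\mathbf{T}(\gamma\overline{X},\beta\overline{Y})$. The Cartan connection $\nabla$ is the unique regular connection on $\pi^{-1}(TM)$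 with $\nabla g=0$, $Q=0$ and $g(T(\overline{X},\overline{Y}),\overline{Z})=g(T(\overline{X},\overline{Z}),\overline{Y})$. A $\pi$-vector field $\overline{\zeta}$ is concurrent if $\nabla_{\beta\overline{X}}\overline{\zeta}=-\overline{X}$ and $\nabla_{\gamma\overline{X}}\overline{\zeta}=0$ for all $\overline{X}$. $\beta$ and $\widetilde{\beta}$ denote the horizontal maps of $\nabla$ (the Cartan connection of $L$) and $\widetilde{\nabla}$ (the Cartan connection of $\widetilde{L}$) respectively. *)

(* Defs.v *)
From mathcomp Require Export all_boot all_order all_algebra.
From mathcomp Require Export all_classical all_reals all_analysis.
Export numFieldNormedType.Exports.
Set Implicit Arguments.
Unset Strict Implicit.
Unset Printing Implicit Defensive.
Import Order.TTheory GRing.Theory Num.Theory.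
Local Open Scope classical_set_scope.
Local Open Scope ring_scope.

Fixpoint Ck (R : realType) (V W : normedModType R) (k : nat) (O : set V)
    (f : V -> W) : Prop :=
  match k with
  | 0 => forall x, O x -> {for x, continuous f}
  | k'.+1 => (forall x, O x -> differentiable f x) /\
             (forall v : V, Ck k' O (fun x => 'D_v f x))
  end.

Definition smooth_on (R : realType) (V W : normedModType R) (O : set V)
    (f : V -> W) : Prop :=
  open O /\ forall k, Ck k O f.

(** Only the values of [coord] on [dom] are meaningful. *)
Record chart (R : realType) (m : nat) (T : Type) := Chart {
  dom : set T ;
  coord : T -> 'rV[R]_m }.

(** ** Calculus relative to an atlas

    The set covered by the atlas [A] may be a proper subset of [T]: the slit
    tangent bundle below is realised in this way, inside a larger type. *)
Section Calculus.
Context {R : realType} {m : nat} {T : Type}.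
Variable A : set (chart R m T).

Definition near_pt (u : T) (P : T -> Prop) : Prop :=
  exists c : chart R m T, [/\ A c, dom c u &
    \forall z \near coord c u, forall w, dom c w -> coord c w = z -> P w].

Definition smooth_near (u : T) (f : T -> R) : Prop :=
  exists (c : chart R m T) (O : set 'rV[R]_m) (h : 'rV[R]_m -> R),
    [/\ A c, dom c u, O (coord c u), smooth_on O h &
        forall w, dom c w -> O (coord c w) -> f w = h (coord c w)].

Definition smooth_curve (c : R -> T) : Prop :=
  exists (a : chart R m T) (O : set R),
    [/\ A a, O 0, forall t, O t -> dom a (c t) &
        smooth_on O (fun t => coord a (c t))].

(** A tangent vector at [p] acts on functions that are smooth near [p]; as it
    is encoded by a functional on all functions, the irrelevant values are
    normalised to 0, so that Leibniz equality is equality of tangent vectors. *)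
Definition normalize (p : T) (v : (T -> R) -> R) : (T -> R) -> R :=
  fun f => if `[< smooth_near p f >] then v f else 0.

Definition velocity (c : R -> T) : (T -> R) -> R :=
  normalize (c 0) (fun f => derive1 (f \o c) 0).

Definition tangent (p : T) (v : (T -> R) -> R) : Prop :=
  exists c : R -> T, [/\ smooth_curve c, c 0 = p & v = velocity c].

Definition vfield_near (u : T) (X : T -> (T -> R) -> R) : Prop :=
  near_pt u (fun w => tangent w (X w)) /\
  forall f, smooth_near u f -> smooth_near u (fun w => X w f).

Definition bracket (X Y : T -> (T -> R) -> R) (u : T) : (T -> R) -> R :=
  normalize u (fun f => X u (fun w => Y w f) - Y u (fun w => X w f)).

End Calculus.

(** ** Manifolds *)

Definition paracompact (T : topologicalType) : Prop :=
  forall F : set (set T), F `<=` open -> \bigcup_(U in F) U = setT ->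
  exists G : set (set T), [/\ G `<=` open, \bigcup_(V in G) V = setT,
    forall V, G V -> exists2 U, F U & V `<=` U &
    forall x : T, exists2 W, nbhs x W &
      finite_set [set V | G V /\ V `&` W !=set0]].

(** The third condition makes each [coord c] a homeomorphism from the open set
    [dom c] onto an open set; the last one is smoothness of the transition
    maps, and contains that of their inverses by exchanging [a] and [b]. *)
Definition smooth_atlas (R : realType) (n : nat) (T : topologicalType)
    (A : set (chart R n T)) : Prop :=
  [/\ forall x, exists2 c, A c & dom c x,
      forall c, A c -> open (dom c) /\
        (forall x y, dom c x -> dom c y -> coord c x = coord c y -> x = y),
      forall c, A c -> forall W, W `<=` dom c ->
        (open W <-> open (coord c @` W)) &
      forall a b, A a -> A b -> exists2 h : 'rV[R]_n -> 'rV[R]_n,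
        smooth_on (coord a @` (dom a `&` dom b)) h &
        forall x, dom a x -> dom b x -> coord b x = h (coord a x)].

Record manifold (R : realType) (n : nat) := Manifold {
  carrier :> topologicalType ;
  atlas : set (chart R n carrier) ;
  manifold_hausdorff : hausdorff_space carrier ;
  manifold_paracompact : paracompact carrier ;
  manifold_atlas : smooth_atlas atlas }.

Arguments atlas {R n} M : rename.

(** ** The slit tangent bundle and the pullback bundle

    A point [u] of the slit tangent bundle is a pair (base point [u.1], nonzero
    tangent vector [u.2]).  A section of the pullback of TM to it is
    a function sending [u] to an element of the tangent space at [u.1]. *)

Section SlitBundle.
Context {R : realType} {n : nat}.
Variable M : manifold R n.

Notation vec := ((M -> R) -> R).
Notation TM := (M * vec)%type.
Notation vecT := ((TM -> R) -> R).

Definition slit : set TM :=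
  [set u | tangent (atlas M) u.1 u.2 /\ u.2 <> 0].

(** The coordinates (x^i, y^i) induced by a chart (x^i) of M, where
    y^i = u(x^i). *)
Definition slit_chart (c : chart R n M) : chart R (n + n) TM :=
  Chart [set u | slit u /\ dom c u.1]
        (fun u => row_mx (coord c u.1)
                         (\row_i u.2 (fun x => coord c x ord0 i))).

Definition slit_atlas : set (chart R (n + n) TM) :=
  [set slit_chart c | c in atlas M].

Definition section_near (u : TM) (s : TM -> vec) : Prop :=
  near_pt slit_atlas u (fun w => tangent (atlas M) w.1 (s w)) /\
  forall f, smooth_near (atlas M) u.1 f ->
    smooth_near slit_atlas u (fun w => s w f).

(** The elements of X(pi(M)), and the vector fields on the slit bundle. *)
Definition pi_vfield (s : TM -> vec) : Prop :=
  forall u, slit u -> section_near u s.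

Definition slit_vfield (X : TM -> vecT) : Prop :=
  forall u, slit u -> vfield_near slit_atlas u X.

Definition eta : TM -> vec := snd.

Definition rho (u : TM) (xi : vecT) : vec :=
  normalize (atlas M) u.1 (fun f => xi (fun w => f w.1)).

(** [gamma u v] is the velocity at t = 0 of the curve t |-> u + t v of the
    fibre of [u]. *)
Definition gamma (u : TM) (v : vec) : vecT :=
  velocity slit_atlas (fun t : R => (u.1, u.2 + t *: v)).

(** ** Linear connections on the pullback bundle

    [D u xi s] is the covariant derivative of the section [s] along the vector
    [xi] tangent to the slit tangent bundle at [u]; it is relevant for
    the sections that are defined and smooth in a neighbourhood of [u]. *)
Definition connection : Type := TM -> vecT -> (TM -> vec) -> vec.

Definition linear_connection (D : connection) : Prop :=
  [/\ forall u xi s, slit u -> tangent slit_atlas u xi -> section_near u s ->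
        tangent (atlas M) u.1 (D u xi s),
      forall u (a : R) xi xi' s, slit u ->
        tangent slit_atlas u xi -> tangent slit_atlas u xi' ->
        section_near u s ->
        D u (a *: xi + xi') s = a *: D u xi s + D u xi' s,
      forall u xi s s', slit u -> tangent slit_atlas u xi ->
        section_near u s -> section_near u s' ->
        D u xi (fun w => s w + s' w) = D u xi s + D u xi s',
      forall u xi (F : TM -> R) s, slit u -> tangent slit_atlas u xi ->
        smooth_near slit_atlas u F -> section_near u s ->
        D u xi (fun w => F w *: s w) = xi F *: s u + F u *: D u xi s &
      forall u X s, slit u -> vfield_near slit_atlas u X ->
        section_near u s -> section_near u (fun w => D w (X w) s)].

Definition connection_map (D : connection) (u : TM) (xi : vecT) : vec :=
  D u xi eta.

Definition vertical (u : TM) : set vecT :=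
  [set xi | tangent slit_atlas u xi /\ rho u xi = 0].

Definition kerK (D : connection) (u : TM) : set vecT :=
  [set xi | tangent slit_atlas u xi /\ connection_map D u xi = 0].

Definition regular (D : connection) : Prop :=
  forall u, slit u ->
    (forall xi, tangent slit_atlas u xi ->
       exists v h, [/\ vertical u v, kerK D u h & xi = v + h]) /\
    vertical u `&` kerK D u `<=` [set 0].

(** The horizontal map: the inverse of [rho u] restricted to [kerK D u]. *)
Definition beta (D : connection) (u : TM) (v : vec) : vecT :=
  xget 0 [set xi | kerK D u xi /\ rho u xi = v].

Definition torsion (D : connection) (X Y : TM -> vecT) (u : TM) : vec :=
  D u (X u) (fun w => rho w (Y w)) - D u (Y u) (fun w => rho w (X w))
  - rho u (bracket slit_atlas X Y u).

Definition torsionQ (D : connection) (X Y : TM -> vec) : TM -> vec :=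
  torsion D (fun w => beta D w (X w)) (fun w => beta D w (Y w)).

Definition torsionT (D : connection) (X Y : TM -> vec) : TM -> vec :=
  torsion D (fun w => gamma w (X w)) (fun w => beta D w (Y w)).

(** ** Finsler structures

    [finsler_metric L u v w] is (1/2) d^2/ds dt L^2(u + s v + t w) at s = t = 0,
    that is g_ij v^i w^j with g_ij = (1/2) d^2 L^2 / dy^i dy^j. *)
Definition finsler_metric (L : TM -> R) (u : TM) (v w : vec) : R :=
  2^-1 * derive1 (fun s : R =>
           derive1 (fun t : R => L (u.1, u.2 + s *: v + t *: w) ^+ 2) 0) 0.

(** Only the values of [L] on nonzero vectors are used; by homogeneity, the
    extension by 0 to the zero section is automatically continuous. *)
Definition finsler (L : TM -> R) : Prop :=
  [/\ forall u, slit u -> smooth_near slit_atlas u L,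
      forall u, slit u -> 0 < L u,
      forall u (a : R), slit u -> 0 < a -> L (u.1, a *: u.2) = a * L u &
      forall u v, slit u -> tangent (atlas M) u.1 v -> v <> 0 ->
        0 < finsler_metric L u v v].

Definition metric_connection (L : TM -> R) (D : connection) : Prop :=
  forall u xi Y Z, slit u -> tangent slit_atlas u xi ->
    section_near u Y -> section_near u Z ->
    xi (fun w => finsler_metric L w (Y w) (Z w)) =
    finsler_metric L u (D u xi Y) (Z u) + finsler_metric L u (Y u) (D u xi Z).

Definition cartan_connection (L : TM -> R) (D : connection) : Prop :=
  [/\ linear_connection D, regular D, metric_connection L D,
      forall u X Y, slit u -> section_near u X -> section_near u Y ->
        torsionQ D X Y u = 0 &
      forall u X Y Z, slit u ->
        section_near u X -> section_near u Y -> section_near u Z ->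
        finsler_metric L u (torsionT D X Y u) (Z u) =
        finsler_metric L u (torsionT D X Z u) (Y u)].

Definition concurrent (D : connection) (zeta : TM -> vec) : Prop :=
  pi_vfield zeta /\
  forall u v, slit u -> tangent (atlas M) u.1 v ->
    D u (beta D u v) zeta = - v /\ D u (gamma u v) zeta = 0.

End SlitBundle.

Arguments slit {R n} M.
Arguments slit_atlas {R n} M.
Arguments connection {R n} M.

(* Main.v *)
From HB Require Import structures.
From mathcomp Require Import lra.
Require Import Defs.

(** The theorem is true because a Cartan connection is determined by its defining
    properties, and the connection D on the right-hand side of the relation,
    [nabla] corrected by a multiple of [zeta], has these properties for the
    changed metric.

    The key fact about a concurrent section is that its square norm
    f = g (zeta, zeta) satisfies xi f = - 2 g (rho xi, zeta) for every vector
    [xi] ([zeta_norm_derive]): the dual 1-form g (zeta, .) is exact, with a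
    potential that is constant along the fibres. Since derivatives along the
    base and along the fibre commute, the components of this 1-form are
    constant along the fibres too ([fiber_field_zeta_dual]). Hence the Cartan
    tensor is orthogonal to [zeta] ([zeta_fiber_conn], [conn_gamma_zeta]), the
    function B is linear along the fibres ([fiber_field_B]), and the changed
    metric is g + g (zeta, .) g (zeta, .) ([changed_metricE]). It has the same
    Cartan tensor as [g], so that both connections have the same vertical part
    ([changed_fiber_conn]); this is (a).

    There remains the difference S between the changed connection and D, along
    vectors that are horizontal for [nabla]. Both are compatible with the
    changed metric, so S is skew ([defect_skew]). The two conditions Q = 0 refer
    to different horizontal maps, which differ by a vertical lift expressed by
    S and [zeta] ([changed_beta]); they say that S minus a term
    C (S (., eta), .) is symmetric, where C is the vertical part of the
    connections ([defect_sym]). As the Cartan tensor is totally symmetric and kills the fundamental vector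
    ([fiber_field_metric_sym], [fiber_field_metric_eta]), an elementary
    argument forces S = 0 ([skew_defect_eq0]). Formula (b) follows by splitting
    a vector horizontal for the changed connection with respect to [nabla]
    ([horizontal_vertical]).

    The metric properties of a Finsler structure all come from the formula
    [finsler_metricE], which writes the metric as half a second derivative of
    the energy along coordinate fields of the slit bundle. For this, smooth
    functions and tangent vectors are shown to be independent of the chart;
    this only uses that charts are injective with smooth transition maps
    ([compatible_charts]), and applies to the manifold and to the slit bundle
    alike. *)

Set Implicit Arguments.
Unset Strict Implicit.
Unset Printing Implicit Defensive.
Import Order.TTheory GRing.Theory Num.Theory.
Local Open Scope classical_set_scope.
Local Open Scope ring_scope.

(** * Maps of class C^k *)

Section SmoothCalculus.
Context {R : realType}.

Lemma near_eq_differentiable (V W : normedModType R) (f g : V -> W) (x : V) :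
  (\forall y \near x, f y = g y) -> differentiable f x -> differentiable g x.
Proof.
move=> fg /diffP[dfc dfE].
apply/diffP; apply: (@getPex _ (fun df : {linear V -> W} => continuous df /\
  forall y, g y = g (lim (nbhs x)) + df (y - lim (nbhs x))
                  +o_(y \near x) (y - lim (nbhs x)))).
exists ('d f x : {linear V -> W}); split=> //.
move: dfE; rewrite lim_id// -(nbhs_singleton fg).
set h := fun y => f x + 'd f x (y - x) => dfE.
have /eqaddoP fE : f = h +o_ (nbhs x) (fun y => y - x) by rewrite funeqE.
suff : g = h +o_ (nbhs x) (fun y => y - x) by rewrite funeqE.
apply/eqaddoP => e e0; have := fE e e0; apply: filterS2 fg => y fgy.
by rewrite !fctE fgy.
Qed.

Variables (V : normedModType R).

Lemma open_nbhs_eq (W : Type) (O : set V) (f g : V -> W) x : open O -> O x ->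
  (forall y, O y -> f y = g y) -> \forall y \near x, f y = g y.
Proof. by move=> oO Ox fg; apply: filterS fg _; exact: open_nbhs_nbhs. Qed.

Lemma Ck_ext (W : normedModType R) k (O : set V) (f g : V -> W) :
  open O -> (forall x, O x -> f x = g x) -> Ck k O f -> Ck k O g.
Proof.
move=> oO; elim: k f g => [|k IHk] f g fg /=.
  move=> fc x Ox; have fgx := open_nbhs_eq oO Ox fg.
  change (g @ x --> g x); rewrite -fg//; apply: cvg_trans (fc _ Ox).
  by apply: near_eq_cvg; move: fgx; apply: filterS => y ->.
move=> [df Df]; split=> [x Ox|v].
  exact: near_eq_differentiable (open_nbhs_eq oO Ox fg) (df _ Ox).
apply: IHk (Df v) => x Ox; apply: near_eq_derive.
exact: (open_nbhs_eq oO Ox fg).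
Qed.

Lemma CkS (W : normedModType R) k (O : set V) (f : V -> W) : Ck k.+1 O f -> Ck k O f.
Proof.
elim: k f => [|k IHk] f /= [df Df].
  by move=> x Ox; apply: differentiable_continuous; exact: df.
by split=> // v; apply: IHk; exact: Df.
Qed.

Lemma Ck_subset (W : normedModType R) k (O O' : set V) (f : V -> W) :
  O' `<=` O -> Ck k O f -> Ck k O' f.
Proof.
move=> OO; elim: k f => [|k IHk] f /=; first by move=> fc x /OO; exact: fc.
by move=> [df Df]; split=> [x /OO|v]; [exact: df|exact: IHk].
Qed.

Lemma Ck_cst (W : normedModType R) k (O : set V) (w : W) : Ck k O (fun=> w).
Proof.
elim: k w => [|k IHk] w /=; first by move=> x _; exact: cvg_cst.
split=> [x _|v]; first exact: differentiable_cst.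
have -> : 'D_v (fun=> w : W) = (fun=> 0) :> (V -> W); last exact: IHk.
by apply/funext => x; exact: derive_cst.
Qed.

Lemma CkD (W : normedModType R) k (O : set V) (f g : V -> W) : open O ->
  Ck k O f -> Ck k O g -> Ck k O (fun x => f x + g x).
Proof.
move=> oO; elim: k f g => [|k IHk] f g /=.
  by move=> cf cg x Ox; apply: cvgD; [exact: cf|exact: cg].
move=> [df Df] [dg Dg]; split=> [x Ox|v].
  by apply: differentiableD; [exact: df|exact: dg].
apply: Ck_ext (IHk _ _ (Df v) (Dg v)) => // x Ox.
by rewrite -deriveD//; apply: diff_derivable; [exact: df|exact: dg].
Qed.

Lemma Ck_sum (W : normedModType R) k (O : set V) I (r : seq I) (f : I -> V -> W) :
  open O -> (forall i, Ck k O (f i)) -> Ck k O (fun x => \sum_(i <- r) f i x).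
Proof.
move=> oO fk; elim: r => [|i r IHr].
  by under eq_fun do rewrite big_nil; exact: Ck_cst.
by under eq_fun do rewrite big_cons; exact: CkD.
Qed.

Lemma CkM k (O : set V) (f g : V -> R) : open O ->
  Ck k O f -> Ck k O g -> Ck k O (fun x => f x * g x).
Proof.
move=> oO; elim: k f g => [|k IHk] f g.
  by move=> cf cg x Ox; apply: cvgM; [exact: cf|exact: cg].
move=> fk gk; have [df Df] := fk; have [dg Dg] := gk.
split=> [x Ox|v].
  by apply: differentiableM; [exact: df|exact: dg].
apply: (@Ck_ext _ _ _ (fun x => f x * 'D_v g x + g x * 'D_v f x)) => //.
  move=> x Ox; apply/esym/(deriveM (f := f) (g := g)).
    by apply: diff_derivable; exact: df.
  by apply: diff_derivable; exact: dg.
by apply: CkD => //; [exact: IHk (CkS fk) (Dg v)|exact: IHk (CkS gk) (Df v)].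
Qed.

Lemma is_diff_linear (U W : normedModType R) (l : U -> W) x :
  linear l -> continuous l -> is_diff x l l.
Proof.
move=> ll cl; pose lM := GRing.isLinear.Build _ _ _ _ l ll.
pose L : {linear U -> W} := HB.pack l lM.
split; first exact: (@linear_differentiable _ _ _ L).
exact: (@diff_lin _ _ _ L).
Qed.

Lemma derive_linear_comp (W W' : normedModType R) (l : W -> W')
  (f : V -> W) x v : linear l -> continuous l -> differentiable f x ->
  'D_v (l \o f) x = l ('D_v f x).
Proof.
move=> ll cl df; have dl := is_diff_linear (f x) ll cl.
have dlf : differentiable l (f x) by [].
rewrite !deriveE//; last exact: differentiable_comp.
by rewrite diff_comp//= diff_val.
Qed.

(** Linear maps commute with every [derive], so the class is kept by induction. *)
Lemma Ck_linear_comp (W W' : normedModType R) (l : W -> W') k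
  (O : set V) (f : V -> W) : open O -> linear l -> continuous l -> Ck k O f ->
  Ck k O (l \o f).
Proof.
move=> oO ll cl; elim: k f => [|k IHk] f /=.
  by move=> cf x Ox; apply: continuous_comp; [exact: cf|exact: cl].
move=> [df Df]; split=> [x Ox|v].
  have dl := is_diff_linear (f x) ll cl.
  by apply: differentiable_comp; [exact: df|exact: ex_diff].
by apply: Ck_ext (IHk _ (Df v)) => // x Ox; rewrite derive_linear_comp//; exact: df.
Qed.

Lemma linear_Ck (W : normedModType R) (l : V -> W) k (O : set V) :
  linear l -> continuous l -> Ck k O l.
Proof.
move=> ll cl; case: k => [|k] /=; first by move=> x _; exact: cl.
have dl x := is_diff_linear x ll cl.
split=> [x _|v]; first exact: ex_diff.
have -> : 'D_v l = (fun=> l v) :> (V -> W); last exact: Ck_cst.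
by apply/funext => x; rewrite deriveE ?diff_val//; exact: ex_diff.
Qed.

(** * Symmetry of second derivatives *)

(** Both sides are limits of the same difference quotient, in which only the
    restrictions to the two lines occur. *)
Lemma eq_along_line (U U' W : normedModType R) (f : U -> W) (g : U' -> W)
  a b v w : (forall h : R, f (h *: v + a) = g (h *: w + b)) ->
  'D_v f a = 'D_w g b /\ (derivable f a v -> derivable g b w).
Proof.
move=> fg; have fgab : f a = g b by have := fg 0; rewrite !scale0r !add0r.
rewrite /derive /derivable.
suff -> : (fun h : R => h^-1 *: ((f \o shift a) (h *: v) - f a)) =
          (fun h : R => h^-1 *: ((g \o shift b) (h *: w) - g b)) by [].
by apply/funext => h /=; rewrite fg fgab.
Qed.

Lemma derive_line (W : normedModType R) (g : V -> W) x v (s : R) :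
  'D_1 (fun t : R => g (x + t *: v)) s = 'D_v g (x + s *: v).
Proof.
apply: proj1; apply: eq_along_line => h.
by rewrite [h *: 1]mulr1 scalerDl addrCA.
Qed.

Lemma derivable_line (W : normedModType R) (g : V -> W) x v (s : R) :
  derivable g (x + s *: v) v ->
  derivable (fun t : R => g (x + t *: v)) s 1.
Proof.
apply: proj2; apply: eq_along_line => h.
by rewrite [h *: 1]mulr1 scalerDl addrCA.
Qed.

Lemma MVT_line (g : V -> R) x v (h : R) : 0 < h ->
  (forall s, 0 <= s <= h -> differentiable g (x + s *: v)) ->
  exists2 s, 0 <= s <= h & g (x + h *: v) - g x = 'D_v g (x + s *: v) * h.
Proof.
move=> h0 dg.
have dl s : 0 <= s <= h ->
    is_derive s 1 (fun t : R => g (x + t *: v)) ('D_v g (x + s *: v)).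
  move=> /dg ?; apply: DeriveDef; last exact: derive_line.
  by apply: derivable_line; exact: diff_derivable.
have [|/= |s] := @MVT _ (fun t => g (x + t *: v)) (fun s => 'D_v g (x + s *: v)) _ _ h0.
- by move=> s; rewrite in_itv/= => /andP[s0 sh]; apply: dl; rewrite !ltW.
- apply: derivable_within_continuous => s; by rewrite in_itv/= => /dl[].
rewrite in_itv/= scale0r addr0 subr0 => /andP[s0 sh] E.
by exists s => //; rewrite !ltW.
Qed.

Lemma derive_translate (W : normedModType R) (f : V -> W) x a v :
  'D_v (fun z => f (z + a)) x = 'D_v f (x + a).
Proof.
by apply: proj1; apply: eq_along_line => h; rewrite addrA.
Qed.

Lemma differentiable_translate (W : normedModType R) (f : V -> W) x a :
  differentiable f (x + a) -> differentiable (fun z => f (z + a)) x.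
Proof.
move=> df; apply: (@differentiable_comp _ _ _ _ (fun z => z + a)) => //.
Qed.

#[local] Opaque derive.

(** The mean value theorem is used twice: for the increment of [f] by [h *: w],
    as a function moving along [v], and then for ['D_v f] moving along [w]. *)
Lemma second_difference (f : V -> R) (O : set V) x v w (h : R) : 0 < h ->
  Ck 2 O f ->
  (forall s t, 0 <= s <= h -> 0 <= t <= h -> O (x + s *: v + t *: w)) ->
  exists s t, [/\ 0 <= s <= h, 0 <= t <= h &
    f (x + h *: v + h *: w) - f (x + h *: v) - f (x + h *: w) + f x =
    'D_w ('D_v f) (x + s *: v + t *: w) * h * h].
Proof.
move=> h0 [df Df] Oh; have hh : 0 <= h <= h by rewrite lexx ltW.
have h00 : (0 : R) <= 0 <= h by rewrite lexx ltW.
have Oh0 s : 0 <= s <= h -> O (x + s *: v).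
  by move=> /Oh/(_ h00); rewrite scale0r addr0.
pose g z := f (z + h *: w) - f z.
have dg s : 0 <= s <= h -> differentiable g (x + s *: v).
  move=> sh; apply: differentiableB; last exact/df/Oh0.
  by apply: differentiable_translate; exact/df/Oh.
have [s sh gE] := MVT_line h0 dg.
have [t th dE] : exists2 t, 0 <= t <= h &
    'D_v f (x + s *: v + h *: w) - 'D_v f (x + s *: v) =
    'D_w ('D_v f) (x + s *: v + t *: w) * h.
  apply: (MVT_line (g := 'D_v f) (x := x + s *: v) (v := w) h0) => t th.
  by case: (Df v) => + _; apply; exact: Oh.
exists s, t; split=> //; rewrite -dE.
transitivity (g (x + h *: v) - g x); first by rewrite /g opprB addrA addrAC.
rewrite gE; congr (_ * _); rewrite deriveB ?derive_translate//.
  by apply: diff_derivable; apply: differentiable_translate; exact/df/Oh.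
by apply: diff_derivable; exact/df/Oh0.
Qed.

(** The second difference is symmetric in [v] and [w]; at arbitrarily small
    scale it evaluates either mixed derivative at points close to [x], where
    continuity compares it with the value at [x]. *)
Lemma derive_comm (f : V -> R) (O : set V) x v w : open O -> O x ->
  Ck 2 O f -> 'D_v ('D_w f) x = 'D_w ('D_v f) x.
Proof.
move=> oO Ox fk; apply/eqP; rewrite -subr_eq0 -normr_le0.
apply/ler_addgt0Pl => e e0; rewrite addr0.
have aux (a b c : R) : `|a - c| < e / 2 -> `|b - c| < e / 2 -> `|a - b| <= e.
  rewrite (distrC b) => ac bc.
  by rewrite [e]splitr -(subrKA c) (le_trans (ler_normD _ _))// lerD// ltW.
have near_half (g : V -> R) : {for x, continuous g} ->
    \forall z \near x, `|g x - g z| < e / 2.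
  by move/cvgrPdist_lt; apply; rewrite divr_gt0.
have Avw := near_half _ (((proj2 fk) w).2 v x Ox).
have Awv := near_half _ (((proj2 fk) v).2 w x Ox).
have /nbhs_ballP[d d0 dP] : \forall z \near x, [/\ O z,
    `|'D_v ('D_w f) x - 'D_v ('D_w f) z| < e / 2 &
    `|'D_w ('D_v f) x - 'D_w ('D_v f) z| < e / 2].
  have AO : \forall z \near x, O z by exact: open_nbhs_nbhs.
  move: AO Avw Awv; apply: filterS3 => z Oz az bz; split; [exact: Oz| |].
    exact: az.
  exact: bz.
(* The parallelogram of sides h *: v and h *: w lies in the ball of radius d. *)
pose N := `|v| + `|w| + 1; have N0 : 0 < N by rewrite ltr_wpDl// addr_ge0.
pose h := d / (2 * N); have h0 : 0 < h by rewrite divr_gt0// mulr_gt0.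
have hP s t : 0 <= s <= h -> 0 <= t <= h -> ball x d (x + s *: v + t *: w).
  move=> /andP[s0 sh] /andP[t0 th]; rewrite -ball_normE /ball_ /=.
  rewrite -addrA opprD addrA subrr sub0r normrN.
  rewrite (le_lt_trans (ler_normD _ _))// !normrZ !ger0_norm//.
  have : s * `|v| + t * `|w| <= h * N.
    rewrite /N !mulrDr mulr1 ler_wpDr ?(ltW h0)//.
    by apply: lerD; apply: ler_wpM2r.
  move/le_lt_trans; apply; rewrite /h invfM -mulrA -mulrA mulVf ?gt_eqF//.
  by rewrite mulr1 ltr_pdivrMr// ltr_pMr// ltr1n.
have hO s t : 0 <= s <= h -> 0 <= t <= h -> O (x + s *: v + t *: w).
  by move=> sh th; have [] := dP _ (hP _ _ sh th).
have hO' s t : 0 <= s <= h -> 0 <= t <= h -> O (x + s *: w + t *: v).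
  by move=> sh th; rewrite addrAC; exact: hO.
have [s [t [sh th E]]] := second_difference h0 fk hO.
have [s' [t' [sh' th']]] := second_difference h0 fk hO'.
have -> : f (x + h *: w + h *: v) - f (x + h *: w) - f (x + h *: v) + f x =
  f (x + h *: v + h *: w) - f (x + h *: v) - f (x + h *: w) + f x.
  by rewrite (addrAC x) -!addrA; congr (_ + _); rewrite addrCA.
have hn0 : h != 0 by rewrite gt_eqF.
rewrite E => /(mulIf hn0)/(mulIf hn0) E'.
have [_ _ bz] := dP _ (hP _ _ sh th).
have [_ az _] := dP _ (hP _ _ th' sh'); rewrite addrAC -E' in az.
exact: aux az bz.
Qed.

End SmoothCalculus.

#[local] Opaque derive.

(** * Maps between spaces of row vectors *)

Section RowVectors.
Context {R : realType}.

Lemma coord_linear m (j : 'I_m) : linear (fun y : 'rV[R]_m => y ord0 j).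
Proof. by move=> a x y; rewrite !mxE. Qed.

Lemma continuous_coord m (j : 'I_m) : continuous (fun y : 'rV[R]_m => y ord0 j).
Proof. exact: coord_continuous. Qed.

Variable V : normedModType R.

Lemma Ck_coord m k (O : set V) (f : V -> 'rV[R]_m) j : open O ->
  Ck k O f -> Ck k O (fun x => f x ord0 j).
Proof.
move=> oO fk.
exact: (Ck_linear_comp oO (@coord_linear m j) (@continuous_coord m j) fk).
Qed.

Lemma Ck_row m k (O : set V) (f : V -> 'rV[R]_m) : open O ->
  (forall j, Ck k O (fun x => f x ord0 j)) -> Ck k O f.
Proof.
move=> oO fk.
apply: (@Ck_ext _ _ _ _ _ (fun x => \sum_j f x ord0 j *: delta_mx 0 j)) => //.
  by move=> x Ox; rewrite -row_sum_delta.
apply: Ck_sum => // j.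
have ll : linear (fun a : R^o => a *: (delta_mx 0 j : 'rV[R]_m)).
  by move=> a x y; rewrite scalerDl scalerA.
have cl : continuous (fun a : R^o => a *: (delta_mx 0 j : 'rV[R]_m)).
  exact: scalel_continuous.
exact: (Ck_linear_comp oO ll cl (fk j)).
Qed.

Lemma derive_coord m (f : V -> 'rV[R]_m) x v j : differentiable f x ->
  ('D_v f x) ord0 j = 'D_v (fun x => f x ord0 j) x.
Proof.
move=> df; apply/esym.
exact: (derive_linear_comp v (@coord_linear m j) (@continuous_coord m j) df).
Qed.

Lemma derive_linear_dir (W : normedModType R) (f : V -> W) x a v w :
  differentiable f x -> 'D_(a *: v + w) f x = a *: 'D_v f x + 'D_w f x.
Proof. by move=> df; rewrite !deriveE// linearP. Qed.

Lemma derive_row_sum (W : normedModType R) m (f : 'rV[R]_m -> W) x v :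
  differentiable f x -> 'D_v f x = \sum_j v ord0 j *: 'D_(delta_mx 0 j) f x.
Proof.
move=> df; rewrite {1}(row_sum_delta v) deriveE// linear_sum.
by apply: eq_bigr => j _; rewrite linearZ deriveE.
Qed.

Lemma derive_comp (U W : normedModType R) (h : U -> W) (f : V -> U) x v :
  differentiable f x -> differentiable h (f x) ->
  'D_v (h \o f) x = 'D_('D_v f x) h (f x).
Proof.
move=> df dh; rewrite deriveE; last exact: differentiable_comp.
by rewrite diff_comp//= -!deriveE.
Qed.

(** The direction ['D_v f x] of the chain rule varies with [x]; it is expanded on
    the standard basis, so that the induction hypothesis applies to the partial
    derivatives of [h]. *)
Lemma Ck_comp m k (O : set V) (P : set 'rV[R]_m) (h : 'rV[R]_m -> R)
  (f : V -> 'rV[R]_m) : open O -> (forall x, O x -> P (f x)) ->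
  Ck k P h -> Ck k O f -> Ck k O (h \o f).
Proof.
move=> oO OP; elim: k h f OP => [|k IHk] h f OP hk fk.
  by move=> x Ox; apply: continuous_comp; [exact: fk|exact/hk/OP].
have [dh Dh] := hk; have [df Df] := fk.
split=> [x Ox|v].
  by apply: differentiable_comp; [exact: df|exact/dh/OP].
apply: (@Ck_ext _ _ _ _ _ (fun x => \sum_j
  ('D_v f x) ord0 j * ('D_(delta_mx 0 j) h \o f) x)) => //.
  move=> x Ox; rewrite (derive_comp v (df x Ox) (dh _ (OP x Ox))).
  by rewrite (derive_row_sum _ (dh _ (OP x Ox))).
apply: Ck_sum => // j; apply: CkM => //; first by apply: Ck_coord => //; exact: Df.
exact: IHk OP (Dh _) (CkS fk).
Qed.

End RowVectors.

Lemma Ck_comp_row (R : realType) (V : normedModType R) m p k (O : set V) (P : set 'rV[R]_m)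
  (h : 'rV[R]_m -> 'rV[R]_p) (f : V -> 'rV[R]_m) :
  open O -> open P -> (forall x, O x -> P (f x)) ->
  Ck k P h -> Ck k O f -> Ck k O (h \o f).
Proof.
move=> oO oP OP hk fk; apply: Ck_row => // j.
exact: (Ck_comp oO OP (Ck_coord j oP hk) fk).
Qed.

(** * Smooth maps on open sets *)

Section SmoothOn.
Context {R : realType} {V : normedModType R}.
Implicit Types (W : normedModType R) (O : set V).

Lemma smooth_on_ext W O (f g : V -> W) :
  (forall x, O x -> f x = g x) -> smooth_on O f -> smooth_on O g.
Proof. by move=> fg [oO fk]; split=> // k; apply: Ck_ext (fk k). Qed.

Lemma smooth_on_subset W O O1 (f : V -> W) :
  open O1 -> O1 `<=` O -> smooth_on O f -> smooth_on O1 f.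
Proof. by move=> oO1 OO [oO fk]; split=> // k; exact: Ck_subset (fk k). Qed.

Lemma smooth_on_cst W O (w : W) : open O -> smooth_on O (fun=> w).
Proof. by move=> oO; split=> // k; exact: Ck_cst. Qed.

Lemma smooth_onD W O (f g : V -> W) :
  smooth_on O f -> smooth_on O g -> smooth_on O (fun x => f x + g x).
Proof. by move=> [oO fk] [_ gk]; split=> // k; exact: CkD. Qed.

Lemma smooth_onM O (f g : V -> R) :
  smooth_on O f -> smooth_on O g -> smooth_on O (fun x => f x * g x).
Proof. by move=> [oO fk] [_ gk]; split=> // k; exact: CkM. Qed.

Lemma smooth_on_derive W O (f : V -> W) v :
  smooth_on O f -> smooth_on O ('D_v f).
Proof. by move=> [oO fk]; split=> // k; exact: (proj2 (fk k.+1)). Qed.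

Lemma smooth_on_differentiable W O (f : V -> W) x :
  smooth_on O f -> O x -> differentiable f x.
Proof. by move=> [_ /(_ 1)[+ _]]; apply. Qed.

Lemma smooth_on_continuous W O (f : V -> W) x :
  smooth_on O f -> O x -> {for x, continuous f}.
Proof. by move=> [_ /(_ 0)]; apply. Qed.

Lemma smooth_on_derive_comm O (f : V -> R) x v w : smooth_on O f -> O x ->
  'D_v ('D_w f) x = 'D_w ('D_v f) x.
Proof. by move=> [oO fk] Ox; exact: derive_comm oO Ox (fk 2). Qed.

Lemma smooth_on_linear W O (l : V -> W) : open O ->
  linear l -> continuous l -> smooth_on O l.
Proof. by move=> oO ll cl; split=> // k; exact: linear_Ck. Qed.

Lemma open_preimage_on O (W : topologicalType) (P : set W) (f : V -> W) : open O -> open P ->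
  (forall x, O x -> {for x, continuous f}) -> open [set x | O x /\ P (f x)].
Proof.
move=> oO oP cf; rewrite openE => x [Ox Pfx].
apply: (@filterS2 _ (nbhs x) _ O (f @^-1` P)); first by move=> y Oy Py; split.
  exact: open_nbhs_nbhs.
by apply: cf => //; exact: open_nbhs_nbhs.
Qed.

End SmoothOn.

Lemma smooth_on_comp (R : realType) (V : normedModType R) m (O : set V)
  (P : set 'rV[R]_m) (h : 'rV[R]_m -> R) (f : V -> 'rV[R]_m) :
  smooth_on P h -> smooth_on O f -> (forall x, O x -> P (f x)) ->
  smooth_on O (h \o f).
Proof.
by move=> [oP hk] [oO fk] OP; split=> // k; exact: Ck_comp oO OP (hk k) (fk k).
Qed.

Lemma smooth_on_comp_row (R : realType) (V : normedModType R) m p (O : set V)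
  (P : set 'rV[R]_m) (h : 'rV[R]_m -> 'rV[R]_p) (f : V -> 'rV[R]_m) :
  smooth_on P h -> smooth_on O f -> (forall x, O x -> P (f x)) ->
  smooth_on O (h \o f).
Proof.
by move=> [oP hk] [oO fk] OP; split=> // k; exact: Ck_comp_row oO oP OP (hk k) (fk k).
Qed.

Lemma smooth_on_row (R : realType) (V : normedModType R) m (O : set V)
  (f : V -> 'rV[R]_m) : open O ->
  (forall j, smooth_on O (fun x => f x ord0 j)) -> smooth_on O f.
Proof.
by move=> oO fk; split=> // k; apply: Ck_row => // j; have [_] := fk j; apply.
Qed.

Lemma smooth_on_coord (R : realType) (V : normedModType R) m (O : set V)
  (f : V -> 'rV[R]_m) j : smooth_on O f -> smooth_on O (fun x => f x ord0 j).
Proof. by move=> [oO fk]; split=> // k; exact: Ck_coord. Qed.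

Lemma smooth_on_affine (R : realType) (V W : normedModType R) (O : set V)
  (l : V -> W) a : open O -> linear l -> continuous l ->
  smooth_on O (fun x => a + l x).
Proof.
move=> oO ll cl; apply: smooth_onD; first exact: smooth_on_cst.
exact: smooth_on_linear.
Qed.

(** * Functions read in compatible charts *)

Section Charts.
Context {R : realType} {m : nat} {T : Type}.
Variable A : set (chart R m T).

(** What remains of the axioms of an atlas once the topology of [T] is
    forgotten; it is all that differential calculus in charts uses. *)
Definition compatible_charts :=
  (forall c, A c -> forall x y, dom c x -> dom c y ->
     coord c x = coord c y -> x = y) /\
  (forall a b, A a -> A b -> exists2 h : 'rV[R]_m -> 'rV[R]_m,
     smooth_on (coord a @` (dom a `&` dom b)) h &
     forall x, dom a x -> dom b x -> coord b x = h (coord a x)).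

Definition chart_image (c : chart R m T) : set 'rV[R]_m := coord c @` dom c.

(** [f] transported by the inverse of [coord c]; the value 0 is taken off
    [chart_image c]. *)
Definition local_rep (c : chart R m T) (f : T -> R) (z : 'rV[R]_m) : R :=
  xget 0 [set f w | w in dom c `&` [set w | coord c w = z]].

(** The tangent vector at [p] of components [v] in the chart [c], for the encoding
    of tangent vectors as normalised functionals. *)
Definition chart_vec (c : chart R m T) (v : 'rV[R]_m) (p : T) : (T -> R) -> R :=
  normalize A p (fun f => 'D_v (local_rep c f) (coord c p)).

Hypothesis gA : compatible_charts.

Lemma coord_inj c x y : A c -> dom c x -> dom c y -> coord c x = coord c y -> x = y.
Proof. by move=> Ac; exact: gA.1. Qed.

Lemma open_overlap a b : A a -> A b -> open (coord a @` (dom a `&` dom b)).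
Proof. by move=> Aa Ab; have [h []] := gA.2 _ _ Aa Ab. Qed.

Lemma open_chart_image c : A c -> open (chart_image c).
Proof. by move=> Ac; have := open_overlap Ac Ac; rewrite setIid. Qed.

Lemma chart_imageE c w : dom c w -> chart_image c (coord c w).
Proof. by move=> cw; exists w. Qed.

Lemma local_repE c f w : A c -> dom c w -> local_rep c f (coord c w) = f w.
Proof.
move=> Ac cw; rewrite /local_rep; case: xgetP => [y _ [x [cx xw] <-]|].
  by congr f; exact: coord_inj cx cw xw.
by move/(_ (f w)) => /= []; exists w.
Qed.

Lemma overlap_dom (a b : chart R m T) w : A a -> dom a w ->
  (coord a @` (dom a `&` dom b)) (coord a w) -> dom b w.
Proof. by move=> Aa aw [x [ax bx] /(coord_inj Aa ax aw) <-]. Qed.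

(** Neighbourhoods do not depend on the chart: the transition map is continuous,
    and a point whose coordinates fall in the overlap belongs to both charts. *)
Lemma near_ptP c u P : A c -> dom c u -> near_pt A u P <->
  \forall z \near coord c u, forall w, dom c w -> coord c w = z -> P w.
Proof.
move=> Ac cu; split=> [[a [Aa au aP]]|cP]; last by exists c.
have [h hs hE] := gA.2 _ _ Ac Aa.
have Ou : (coord c @` (dom c `&` dom a)) (coord c u) by exists u.
have hc : h @ coord c u --> h (coord c u) := smooth_on_continuous hs Ou.
rewrite -hE// in hc; have hP := hc _ aP.
near=> z => w cw cwz.
have aw : dom a w.
  by apply: (overlap_dom Ac cw); rewrite cwz; near: z; apply: open_nbhs_nbhs; case: hs.
have : forall w', dom a w' -> coord a w' = h z -> P w' by near: z.
by apply; rewrite // -cwz hE.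
Unshelve. all: by end_near. Qed.

(** Smoothness does not depend on the chart either, by composition with the
    transition map. *)
Lemma smooth_nearP c u f : A c -> dom c u -> smooth_near A u f <->
  exists O, [/\ O (coord c u), O `<=` chart_image c & smooth_on O (local_rep c f)].
Proof.
move=> Ac cu; split=> [[a [U [h [Aa au Ou hO fh]]]]|[U [Uu Uc Uf]]].
  have [k kO kE] := gA.2 _ _ Ac Aa.
  have [oca _] := kO; have [oU _] := hO.
  pose O1 := [set z | (coord c @` (dom c `&` dom a)) z /\ U (k z)].
  have oO1 : open O1.
    exact: (open_preimage_on oca oU (fun z => smooth_on_continuous kO)).
  have O1ca : O1 `<=` coord c @` (dom c `&` dom a) by move=> z [].
  exists O1; split.
  - by split; [exists u|rewrite -kE].
  - by move=> z [[w [cw _] <-] _]; exists w.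
  apply: (@smooth_on_ext _ _ _ _ (h \o k)).
    by move=> z [[w [cw aw] <-] Okw] /=; rewrite local_repE// -kE// fh// kE.
  apply: (smooth_on_comp hO); first exact: smooth_on_subset kO.
  by move=> z [].
exists c, U, (local_rep c f); split=> // w cw Uw.
by rewrite local_repE.
Qed.

End Charts.

(** * Neighbourhoods and smooth functions *)

Lemma near_open (T : topologicalType) (x : T) (P : T -> Prop) :
  (\forall z \near x, P z) -> exists U, [/\ open U, U x & forall z, U z -> P z].
Proof.
move=> xP; have : nbhs x P := xP.
by rewrite nbhsE => -[U [oU Ux] UP]; exists U.
Qed.

Section Tangents.
Context {R : realType} {m : nat} {T : Type} {A : set (chart R m T)}.
Hypothesis gA : compatible_charts A.
Implicit Types (c : chart R m T) (u p w : T) (f g : T -> R).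

Lemma near_pt_self u P : near_pt A u P -> P u.
Proof. by move=> [c [Ac cu cP]]; exact: (nbhs_singleton cP). Qed.

Lemma near_pt_chart u P : near_pt A u P -> exists2 c, A c & dom c u.
Proof. by move=> [c [Ac cu _]]; exists c. Qed.

Lemma near_ptW u (P Q : T -> Prop) : (forall w, P w -> Q w) ->
  near_pt A u P -> near_pt A u Q.
Proof.
move=> PQ [c [Ac cu cP]]; exists c; split=> //.
by apply: filterS cP => z zP w cw cwz; exact/PQ/zP.
Qed.

Lemma near_ptI u P Q : near_pt A u P -> near_pt A u Q ->
  near_pt A u (fun w => P w /\ Q w).
Proof.
move=> uP uQ; have [c Ac cu] := near_pt_chart uP.
move: uP uQ => /(near_ptP gA _ Ac cu) cP /(near_ptP gA _ Ac cu) cQ.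
apply/(near_ptP gA _ Ac cu); apply: filterS2 cP cQ => z zP zQ w cw cwz.
by split; [exact: zP|exact: zQ].
Qed.

Lemma near_pt_open u P : near_pt A u P <-> exists c U,
  [/\ A c, dom c u, open U, U (coord c u) & forall w, dom c w -> U (coord c w) -> P w].
Proof.
split=> [[c [Ac cu]]|[c [U [Ac cu oU Uu UP]]]].
  move=> /near_open[U [oU Uu UP]]; exists c, U; split=> // w cw /UP UPw.
  exact: UPw.
have nU : \forall z \near coord c u, U z by exact: open_nbhs_nbhs.
exists c; split=> //; apply: filterS nU => z Uz w cw cwz.
by rewrite -cwz in Uz; exact: UP.
Qed.

Lemma near_pt_dom c u : A c -> dom c u -> near_pt A u (dom c).
Proof. by move=> Ac cu; exists c; split=> //; near=> z. Unshelve. all: by end_near. Qed.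

Lemma near_pt_inv_coord c u : A c -> dom c u -> exists2 O : set 'rV[R]_m, open O & O (coord c u) /\
  forall z, O z -> exists2 w, dom c w & coord c w = z.
Proof.
move=> Ac cu; exists (chart_image c); first exact: (open_chart_image gA Ac).
by split; [exact: chart_imageE|move=> z [w]; exists w].
Qed.

Lemma near_local_rep c u f g : A c -> dom c u ->
  near_pt A u (fun w => f w = g w) ->
  \forall z \near coord c u, local_rep c f z = local_rep c g z.
Proof.
move=> Ac cu /(near_ptP gA _ Ac cu) fg.
have oc : \forall z \near coord c u, chart_image c z.
  by apply: open_nbhs_nbhs; split; [exact: (open_chart_image gA Ac)|exact: chart_imageE].
apply: filterS2 fg oc => z zfg [w cw cwz].
by rewrite -cwz !(local_repE gA)//; exact: zfg.
Qed.

Lemma smooth_near_chart u f : smooth_near A u f -> exists2 c, A c & dom c u.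
Proof. by move=> [c [U [h [Ac cu _ _ _]]]]; exists c. Qed.

Lemma smooth_near_ext u f g : near_pt A u (fun w => f w = g w) ->
  smooth_near A u f -> smooth_near A u g.
Proof.
move=> fg fu; have [c Ac cu] := smooth_near_chart fu.
move: fu => /(smooth_nearP gA _ Ac cu)[U [Uu Uc fU]].
have [P [oP Pu PE]] := near_open (near_local_rep Ac cu fg).
have oU : open U by case: fU.
apply/(smooth_nearP gA _ Ac cu); exists (U `&` P); split=> //; first by move=> z [/Uc].
apply: (@smooth_on_ext _ _ _ _ (local_rep c f)); first by move=> z [_ /PE].
by apply: smooth_on_subset fU; [exact: openI|move=> z []].
Qed.

Lemma near_pt_smooth u f : smooth_near A u f -> near_pt A u (smooth_near A ^~ f).
Proof.
move=> [c [U [h [Ac cu Uu hU fh]]]]; apply/near_pt_open.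
exists c, U; split=> //; first by case: hU.
by move=> w cw Uw; exists c, U, h.
Qed.

Lemma smooth_near_cst c u (a : R) : A c -> dom c u -> smooth_near A u (fun=> a).
Proof.
move=> Ac cu; exists c, setT, (fun=> a); split=> //.
by apply: smooth_on_cst; exact: openT.
Qed.

Lemma smooth_near_coord c u j : A c -> dom c u ->
  smooth_near A u (fun w => coord c w ord0 j).
Proof.
move=> Ac cu; exists c, setT, (fun z => z ord0 j); split=> //.
apply: smooth_on_linear; [exact: openT|exact: coord_linear|exact: coord_continuous].
Qed.

Let local_rep_op2 (op : R -> R -> R) c f g z : A c -> chart_image c z ->
  local_rep c (fun w => op (f w) (g w)) z = op (local_rep c f z) (local_rep c g z).
Proof. by move=> Ac [w cw <-]; rewrite !(local_repE gA). Qed.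

Let smooth_near_op2 (op : R -> R -> R) u f g :
  (forall O (h k : 'rV[R]_m -> R), smooth_on O h -> smooth_on O k ->
     smooth_on O (fun x => op (h x) (k x))) ->
  smooth_near A u f -> smooth_near A u g ->
  smooth_near A u (fun w => op (f w) (g w)).
Proof.
move=> opP fu; have [c Ac cu] := smooth_near_chart fu; move: fu.
move=> /(smooth_nearP gA _ Ac cu)[U [Uu Uc fU]] /(smooth_nearP gA _ Ac cu)[P [Pu Pc gP]].
apply/(smooth_nearP gA _ Ac cu); exists (U `&` P); split=> //; first by move=> z [/Uc].
have oUP : open (U `&` P) by apply: openI; [case: fU|case: gP].
apply: (@smooth_on_ext _ _ _ _ (fun z => op (local_rep c f z) (local_rep c g z))).
  by move=> z [/Uc cz _]; rewrite local_rep_op2.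
by apply: opP; [apply: smooth_on_subset fU|apply: smooth_on_subset gP] => // z [].
Qed.

Lemma smooth_nearD u f g : smooth_near A u f -> smooth_near A u g ->
  smooth_near A u (fun w => f w + g w).
Proof. by apply: smooth_near_op2 => *; exact: smooth_onD. Qed.

Lemma smooth_nearM u f g : smooth_near A u f -> smooth_near A u g ->
  smooth_near A u (fun w => f w * g w).
Proof. by apply: smooth_near_op2 => *; exact: smooth_onM. Qed.

Lemma smooth_near_sum c u I (r : seq I) (f : I -> T -> R) : A c -> dom c u ->
  (forall i, smooth_near A u (f i)) -> smooth_near A u (fun w => \sum_(i <- r) f i w).
Proof.
move=> Ac cu fu; elim: r => [|i r IHr].
  by under eq_fun do rewrite big_nil; exact: smooth_near_cst Ac cu.
by under eq_fun do rewrite big_cons; exact: smooth_nearD.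
Qed.

(** * Tangent vectors in a chart *)

Lemma chart_vecE c p v f : smooth_near A p f ->
  chart_vec A c v p f = 'D_v (local_rep c f) (coord c p).
Proof. by move=> fp; rewrite /chart_vec /normalize asboolT. Qed.

Lemma chart_vec_nonsmooth c p v f : ~ smooth_near A p f -> chart_vec A c v p f = 0.
Proof. by move=> fp; rewrite /chart_vec /normalize asboolF. Qed.

Lemma smooth_near_differentiable c p f : A c -> dom c p -> smooth_near A p f ->
  differentiable (local_rep c f) (coord c p).
Proof.
move=> Ac cp /(smooth_nearP gA _ Ac cp)[U [Uu _ fU]].
exact: smooth_on_differentiable fU Uu.
Qed.

Lemma chart_vec_linear c p a v z : A c -> dom c p ->
  chart_vec A c (a *: v + z) p = a *: chart_vec A c v p + chart_vec A c z p.
Proof.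
move=> Ac cp; apply/funext => f; rewrite !fctE.
have [fp|nfp] := pselect (smooth_near A p f).
  rewrite !chart_vecE// derive_linear_dir//.
  exact: smooth_near_differentiable.
by rewrite !chart_vec_nonsmooth// scaler0 addr0.
Qed.

Lemma chart_vec_coord c p v j : A c -> dom c p ->
  chart_vec A c v p (fun w => coord c w ord0 j) = v ord0 j.
Proof.
move=> Ac cp; rewrite chart_vecE; last exact: smooth_near_coord.
have oc : \forall z \near coord c p, chart_image c z.
  by apply: open_nbhs_nbhs; split; [exact: (open_chart_image gA Ac)|exact: chart_imageE].
rewrite (@near_eq_derive _ _ _ _ (fun z : 'rV[R]_m => z ord0 j)); last first.
  by apply: filterS oc => _ [w cw <-]; rewrite (local_repE gA).
have dj := is_diff_linear (coord c p) (@coord_linear R m j) (@continuous_coord R m j).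
by rewrite deriveE ?diff_val//; exact: ex_diff.
Qed.

Lemma smooth_near_chart_vec c u v f : A c -> dom c u -> smooth_near A u f ->
  smooth_near A u (fun w => chart_vec A c v w f).
Proof.
move=> Ac cu fu.
have [U [Uu Uc fU]] := (smooth_nearP gA f Ac cu).1 fu.
exists c, U, ('D_v (local_rep c f)); split=> //; first exact: smooth_on_derive.
move=> w cw Uw; rewrite chart_vecE//.
by apply/(smooth_nearP gA _ Ac cw); exists U.
Qed.

Lemma derive1_curve c p f (gam : R -> T) (k : R -> 'rV[R]_m) : A c -> dom c p ->
  gam 0 = p -> smooth_near A p f -> differentiable k 0 ->
  (\forall t \near (0 : R), dom c (gam t) /\ coord c (gam t) = k t) ->
  derive1 (f \o gam) 0 = chart_vec A c ('D_1 k 0) p f.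
Proof.
move=> Ac cp g0 fp dk gk; rewrite chart_vecE//.
have k0 : k 0 = coord c p by have [_ <-] := nbhs_singleton gk; rewrite g0.
rewrite -k0 -derive_comp//; last by rewrite k0; exact: smooth_near_differentiable.
rewrite derive1E; apply: near_eq_derive.
by apply: filterS gk => t [cg E] /=; rewrite -E (local_repE gA).
Qed.

Lemma velocity_chart c p (gam : R -> T) (k : R -> 'rV[R]_m) : A c -> dom c p ->
  gam 0 = p -> differentiable k 0 ->
  (\forall t \near (0 : R), dom c (gam t) /\ coord c (gam t) = k t) ->
  velocity A gam = chart_vec A c ('D_1 k 0) p.
Proof.
move=> Ac cp g0 dk gk; rewrite /velocity g0; apply/funext => f.
have [fp|nfp] := pselect (smooth_near A p f); last first.
  by rewrite chart_vec_nonsmooth// /normalize asboolF.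
by rewrite /normalize asboolT//; exact: derive1_curve.
Qed.

Lemma tangent_chart p X : tangent A p X -> exists2 c, A c & dom c p.
Proof.
by move=> [gam [[a [U [Aa U0 Ua _]]] <- _]]; exists a => //; exact: Ua.
Qed.

Lemma smooth_on_line (x v : 'rV[R]_m) (O : set R) : open O ->
  smooth_on O (fun t : R => x + t *: v).
Proof.
move=> oO; apply: (@smooth_on_affine R R _ O (fun t : R => t *: v)) => //.
  by move=> a s t; rewrite scalerDl scalerA.
exact: scalel_continuous.
Qed.

Lemma derive_affine_line (x v : 'rV[R]_m) : 'D_(1 : R) (fun t : R => x + t *: v) 0 = v.
Proof.
have ll : linear (fun t : R => t *: v) by move=> a s t; rewrite scalerDl scalerA.
have dj := is_diff_linear (0 : R) ll (@scalel_continuous _ _ v).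
rewrite (@deriveD _ _ _ (cst x) (fun t : R => t *: v)) ?derive_cst; last 2 first.
- exact: derivable_cst.
- by apply: diff_derivable; exact: ex_diff.
by rewrite add0r deriveE ?diff_val ?scale1r//; exact: ex_diff.
Qed.

(** A curve smooth in another chart is smooth in [c], and its velocity only
    depends on the derivative of its coordinates; conversely, a segment in the
    image of [c] lifts to a curve. *)
Lemma tangentP c p X : A c -> dom c p ->
  tangent A p X <-> exists v, X = chart_vec A c v p.
Proof.
move=> Ac cp; split=> [[gam [[a [U [Aa U0 Ua sU]]] g0 ->]]|[v ->]].
  have ap : dom a p by rewrite -g0; exact: Ua.
  have [k kO kE] := gA.2 _ _ Aa Ac.
  pose P := [set t | U t /\ (coord a @` (dom a `&` dom c)) (coord a (gam t))].
  have oP : open P.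
    apply: (@open_preimage_on _ _ _ _ _ (fun t => coord a (gam t))).
    - by case: sU.
    - by case: kO.
    - by move=> t; exact: smooth_on_continuous sU.
  have P0 : P 0 by split=> //; rewrite g0; exists p.
  have kP : smooth_on P (k \o (fun t => coord a (gam t))).
    apply: smooth_on_comp_row kO _ _; last by move=> t [].
    by apply: smooth_on_subset sU => // t [].
  exists ('D_1 (k \o (fun t => coord a (gam t))) 0).
  apply: velocity_chart => //; first exact: smooth_on_differentiable kP P0.
  have nP : \forall t \near (0 : R), P t by apply: open_nbhs_nbhs.
  apply: filterS nP => t [Ut at'] /=.
  have cgt := overlap_dom gA Aa (Ua _ Ut) at'.
  by split=> //; rewrite kE//; exact: Ua.
pose line t := coord c p + t *: v.
have : forall t, exists w, chart_image c (line t) -> dom c w /\ coord c w = line t.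
  move=> t; have [[w cw cwt]|nt] := pselect (chart_image c (line t)).
    by exists w.
  by exists p.
move=> /choice[gam gamP].
have oc : open (chart_image c) by exact: (open_chart_image gA Ac).
have slT : smooth_on setT line by apply: smooth_on_line; exact: openT.
pose U := [set t | setT t /\ chart_image c (line t)].
have oU : open U.
  exact: (open_preimage_on openT oc (fun t _ => smooth_on_continuous slT I)).
have l0 : line 0 = coord c p by rewrite /line scale0r addr0.
have U0 : U 0 by split=> //; rewrite l0; exact: chart_imageE.
have g0 : gam 0 = p.
  have [cg0 E] := gamP 0 U0.2; apply: (coord_inj gA Ac cg0 cp).
  by rewrite E l0.
exists gam; split=> //.
  exists c, U; split=> //; first by move=> t [_ /gamP[]].
  apply: (@smooth_on_ext _ _ _ _ line); first by move=> t [_ /gamP[_ ->]].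
  exact: smooth_on_subset slT.
have dl : differentiable line (0 : R) := smooth_on_differentiable slT I.
rewrite -[v in LHS](derive_affine_line (coord c p)); apply/esym.
have nU : \forall t \near (0 : R), U t by apply: open_nbhs_nbhs.
apply: (velocity_chart (k := line)) => //.
by apply: filterS nU => t [_ /gamP].
Qed.

Lemma tangent_chart_vec c p v : A c -> dom c p -> tangent A p (chart_vec A c v p).
Proof. by move=> Ac cp; apply/(tangentP _ Ac cp); exists v. Qed.

Lemma tangent_lin p a X Y : tangent A p X -> tangent A p Y -> tangent A p (a *: X + Y).
Proof.
move=> tX; have [c Ac cp] := tangent_chart tX.
move: tX => /(tangentP _ Ac cp)[v ->] /(tangentP _ Ac cp)[w ->].
by rewrite -chart_vec_linear//; exact: tangent_chart_vec.
Qed.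

Lemma chart_vec0 c p : A c -> dom c p -> chart_vec A c 0 p = 0.
Proof.
move=> Ac cp; have := chart_vec_linear (-1) 0 0 Ac cp.
by rewrite scaler0 addr0 scaleN1r addNr.
Qed.

Lemma tangent0 c p : A c -> dom c p -> tangent A p 0.
Proof. by move=> Ac cp; rewrite -(chart_vec0 Ac cp); exact: tangent_chart_vec. Qed.

Lemma tangent_coordE c p X : A c -> dom c p -> tangent A p X ->
  X = chart_vec A c (\row_j X (fun w => coord c w ord0 j)) p.
Proof.
move=> Ac cp /(tangentP _ Ac cp)[v ->]; congr (chart_vec A c _ p).
by apply/rowP => j; rewrite mxE chart_vec_coord.
Qed.

Lemma tangent_near_eq p X f g : tangent A p X ->
  near_pt A p (fun w => f w = g w) -> X f = X g.
Proof.
move=> tX fg; have [c Ac cp] := tangent_chart tX.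
move: tX => /(tangentP _ Ac cp)[v ->].
have gf : near_pt A p (fun w => g w = f w) by apply: near_ptW fg.
have [fp|nfp] := pselect (smooth_near A p f).
  rewrite !chart_vecE//; last exact: smooth_near_ext fg fp.
  by apply: near_eq_derive; exact: near_local_rep.
rewrite !chart_vec_nonsmooth// => gp; apply: nfp.
exact: smooth_near_ext gf gp.
Qed.

Lemma tangentD p X f g : tangent A p X -> smooth_near A p f -> smooth_near A p g ->
  X (fun w => f w + g w) = X f + X g.
Proof.
move=> tX fp gp; have [c Ac cp] := tangent_chart tX.
move: tX => /(tangentP _ Ac cp)[v ->]; rewrite !chart_vecE//; last exact: smooth_nearD.
rewrite -deriveD; last 2 first.
- by apply: diff_derivable; exact: smooth_near_differentiable.
- by apply: diff_derivable; exact: smooth_near_differentiable.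
apply: near_eq_derive; have [U oU [Uu UP]] := near_pt_inv_coord Ac cp.
have nU : \forall z \near coord c p, U z by apply: open_nbhs_nbhs.
by apply: filterS nU => z /UP[w cw <-]; rewrite fctE !(local_repE gA).
Qed.

Lemma tangentM p X f g : tangent A p X -> smooth_near A p f -> smooth_near A p g ->
  X (fun w => f w * g w) = f p * X g + g p * X f.
Proof.
move=> tX fp gp; have [c Ac cp] := tangent_chart tX.
move: tX => /(tangentP _ Ac cp)[v ->]; rewrite !chart_vecE//; last exact: smooth_nearM.
have df : derivable (local_rep c f) (coord c p) v.
  by apply: diff_derivable; exact: smooth_near_differentiable.
have dg : derivable (local_rep c g) (coord c p) v.
  by apply: diff_derivable; exact: smooth_near_differentiable.
have := deriveM df dg; rewrite !(local_repE gA)// => <-.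
apply: near_eq_derive; have [U oU [Uu UP]] := near_pt_inv_coord Ac cp.
have nU : \forall z \near coord c p, U z by apply: open_nbhs_nbhs.
by apply: filterS nU => z /UP[w cw <-]; rewrite fctE !(local_repE gA).
Qed.

Lemma tangent_cst p X (a : R) : tangent A p X -> X (fun=> a) = 0.
Proof.
move=> tX; have [c Ac cp] := tangent_chart tX.
have s1 := smooth_near_cst 1 Ac cp; have sa := smooth_near_cst a Ac cp.
have X1 : X (fun=> 1) = 0.
  have := tangentM tX s1 s1; rewrite mulr1 mul1r => /eqP.
  by rewrite -subr_eq0 opprD addrA subrr sub0r oppr_eq0 => /eqP.
move: tX => /(tangentP _ Ac cp)[v Xv]; rewrite {}Xv in X1 *.
rewrite chart_vecE// -(derive_cst a (coord c p) v); apply: near_eq_derive.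
have [U oU [Uu UP]] := near_pt_inv_coord Ac cp.
have nU : \forall z \near coord c p, U z by apply: open_nbhs_nbhs.
by apply: filterS nU => z /UP[w cw <-]; rewrite (local_repE gA).
Qed.

End Tangents.

(** * Coordinate vector fields *)

Section SecondOrder.
Context {R : realType} {m : nat} {T : Type} {A : set (chart R m T)}.
Hypothesis gA : compatible_charts A.
Implicit Types (c : chart R m T) (u p w : T) (f g : T -> R).

Lemma near_local_rep_chart_vec c u v f : A c -> dom c u -> smooth_near A u f ->
  \forall z \near coord c u,
    local_rep c (fun w => chart_vec A c v w f) z = 'D_v (local_rep c f) z.
Proof.
move=> Ac cu /(smooth_nearP gA _ Ac cu)[U [Uu Uc fU]].
have nU : \forall z \near coord c u, U z.
  by apply: open_nbhs_nbhs; split=> //; case: fU.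
apply: filterS nU => z Uz; have [w cw E] := Uc _ Uz.
rewrite -E (local_repE gA)// chart_vecE//.
by apply/(smooth_nearP gA _ Ac cw); exists U; split=> //; rewrite E.
Qed.

(** In local representatives this is the symmetry of second derivatives. *)
Lemma chart_vec_comm c u v z f : A c -> dom c u -> smooth_near A u f ->
  chart_vec A c v u (fun w => chart_vec A c z w f) =
  chart_vec A c z u (fun w => chart_vec A c v w f).
Proof.
move=> Ac cu fu; have [U [Uu _ fU]] := (smooth_nearP gA f Ac cu).1 fu.
rewrite !chart_vecE; try exact: smooth_near_chart_vec.
transitivity ('D_v ('D_z (local_rep c f)) (coord c u)).
  exact: near_eq_derive (near_local_rep_chart_vec z Ac cu fu).
transitivity ('D_z ('D_v (local_rep c f)) (coord c u)).
  exact: (smooth_on_derive_comm v z fU Uu).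
exact/esym/(near_eq_derive _ (near_local_rep_chart_vec v Ac cu fu)).
Qed.

Lemma chart_vec_sum c p v : A c -> dom c p ->
  chart_vec A c v p = \sum_j v ord0 j *: chart_vec A c (delta_mx 0 j) p.
Proof.
move=> Ac cp; rewrite [in LHS](row_sum_delta v).
elim/big_rec2: _ => [|j x y _ E]; first exact: chart_vec0.
by rewrite chart_vec_linear// E.
Qed.

Lemma tangentZ p a X : tangent A p X -> tangent A p (a *: X).
Proof.
move=> tX; have [c Ac cp] := tangent_chart tX.
by rewrite -[_ *: _]addr0; apply: tangent_lin => //; exact: tangent0 Ac cp.
Qed.

Lemma tangent_add p X Y : tangent A p X -> tangent A p Y -> tangent A p (X + Y).
Proof. by move=> tX tY; rewrite -[X]scale1r; exact: tangent_lin. Qed.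

Lemma tangentN p X : tangent A p X -> tangent A p (- X).
Proof. by move=> tX; rewrite -scaleN1r; exact: tangentZ. Qed.

Lemma tangent_sub p X Y : tangent A p X -> tangent A p Y -> tangent A p (X - Y).
Proof. by move=> tX tY; apply: tangent_add => //; exact: tangentN. Qed.

Lemma tangent_sum c p I (r : seq I) (X : I -> (T -> R) -> R) : A c -> dom c p ->
  (forall i, tangent A p (X i)) -> tangent A p (\sum_(i <- r) X i).
Proof.
move=> Ac cp tX; elim/big_rec: _ => [|i Y _ tY]; first exact: tangent0 Ac cp.
exact: tangent_add.
Qed.

Lemma tangent_sum_fun c p X I (r : seq I) (f : I -> T -> R) : A c -> dom c p ->
  tangent A p X -> (forall i, smooth_near A p (f i)) ->
  X (fun w => \sum_(i <- r) f i w) = \sum_(i <- r) X (f i).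
Proof.
move=> Ac cp tX fp; elim: r => [|i r IHr].
  by under eq_fun do rewrite big_nil; rewrite big_nil; exact: tangent_cst tX.
under eq_fun do rewrite big_cons; rewrite big_cons -IHr.
exact: (tangentD gA tX (fp i) (smooth_near_sum gA r Ac cp fp)).
Qed.

End SecondOrder.

(** * The slit tangent bundle as a space with compatible charts *)

Lemma open_neq0 (R : realType) m : open [set y : 'rV[R]_m | y <> 0].
Proof.
have -> : [set y : 'rV[R]_m | y <> 0] = (fun y => `|y|) @^-1` [set r : R | 0 < r].
  by apply/seteqP; split=> y /=; rewrite normr_gt0 => /eqP.
by apply: open_comp => [y _|]; [exact: norm_continuous|exact: open_gt].
Qed.

Lemma lsubmx_linear (R : realType) m k : linear (lsubmx : 'rV[R]_(m + k) -> 'rV[R]_m).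
Proof. by move=> a x y; rewrite linearP. Qed.

Lemma rsubmx_linear (R : realType) m k : linear (rsubmx : 'rV[R]_(m + k) -> 'rV[R]_k).
Proof. by move=> a x y; rewrite linearP. Qed.

Lemma row_mx_linear0 (R : realType) m k a (v w : 'rV[R]_k) :
  row_mx (0 : 'rV[R]_m) (a *: v + w) = a *: row_mx 0 v + row_mx 0 w.
Proof. by rewrite scale_row_mx add_row_mx scaler0 addr0. Qed.

Section Slit.
Context {R : realType} {n : nat}.
Variable M : manifold R n.

Notation vec := ((M -> R) -> R).
Notation TM := (M * vec)%type.
Notation vecT := ((TM -> R) -> R).
Notation AM := (atlas M).
Notation SM := (slit_atlas M).
Implicit Types (c a b : chart R n M) (u w : TM) (f : M -> R).

Lemma atlas_compatible : compatible_charts AM.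
Proof.
case: (manifold_atlas M) => _ c1 _ c3; split=> [c Ac|]; last exact: c3.
exact: (c1 c Ac).2.
Qed.
Let gM := atlas_compatible.

Definition fiber_coord c u : 'rV[R]_n := \row_i u.2 (fun x => coord c x ord0 i).

Lemma slit_chartE c u : coord (slit_chart c) u = row_mx (coord c u.1) (fiber_coord c u).
Proof. by []. Qed.

Lemma slit_in_chart u : slit M u -> exists2 c, AM c & dom c u.1.
Proof. by move=> [+ _]; exact: tangent_chart. Qed.

Lemma slit_vec_coordE c u : AM c -> dom c u.1 -> slit M u ->
  u.2 = chart_vec AM c (fiber_coord c u) u.1.
Proof. by move=> Ac cu [tu _]; exact: (tangent_coordE gM Ac cu tu). Qed.

Lemma chart_vec_eq0 c v (x : M) : AM c -> dom c x -> chart_vec AM c v x = 0 -> v = 0.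
Proof.
move=> Ac cx v0; apply/rowP => j.
by rewrite -(chart_vec_coord gM v j Ac cx) v0 mxE.
Qed.

Lemma fiber_coord_chart_vec c v (x : M) : AM c -> dom c x ->
  fiber_coord c (x, chart_vec AM c v x) = v.
Proof. by move=> Ac cx; apply/rowP => j; rewrite mxE /= (chart_vec_coord gM). Qed.

Lemma slit_chart_vec c v (x : M) : AM c -> dom c x -> v <> 0 ->
  slit M (x, chart_vec AM c v x).
Proof.
move=> Ac cx v0; split=> /=; first exact: tangent_chart_vec.
by move=> /(chart_vec_eq0 Ac cx).
Qed.

Lemma slit_overlap_image a b : AM a -> AM b ->
  coord (slit_chart a) @` (dom (slit_chart a) `&` dom (slit_chart b)) =
  [set z | (coord a @` (dom a `&` dom b)) (lsubmx z) /\ rsubmx z <> 0].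
Proof.
move=> Aa Ab; apply/seteqP; split=> [_ [u [[su au] [_ bu]] <-]|z [[x [ax bx] xz] z0]].
  split; rewrite slit_chartE ?row_mxKl ?row_mxKr; first by exists u.1.
  move=> f0; case: (su) => _; apply.
  by rewrite (slit_vec_coordE Aa au su) f0 (chart_vec0 gM).
exists (x, chart_vec AM a (rsubmx z) x).
  by have := slit_chart_vec Aa ax z0.
by rewrite slit_chartE /= fiber_coord_chart_vec// xz hsubmxK.
Qed.

(** The transition map is the tangent map (x, y) |-> (h(x), Dh(x) y) of a
    transition map of the base; its fibre part is linear in y with
    coefficients the partial derivatives of h, hence smooth. *)
Lemma slit_compatible : compatible_charts SM.
Proof.
split.
  move=> _ [c Ac <-] u w [su cu] [sw cw] /=.
  move=> /eq_row_mx[E1 E2]; have E := gM.1 _ Ac _ _ cu cw E1.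
  rewrite (surjective_pairing u) (surjective_pairing w) -E; congr pair.
  rewrite (slit_vec_coordE Ac cu su) (slit_vec_coordE Ac cw sw) -E.
  by rewrite /fiber_coord E2.
move=> _ _ [a Aa <-] [b Ab <-]; have [h hs hE] := gM.2 _ _ Aa Ab.
pose P := coord a @` (dom a `&` dom b).
pose O := [set z : 'rV[R]_(n + n) | P (lsubmx z) /\ rsubmx z <> 0].
have oP : open P by case: hs.
have oO : open O.
  have oN : open [set z : 'rV[R]_(n + n) | rsubmx z <> 0].
    apply: (@open_comp _ _ rsubmx [set y : 'rV[R]_n | y <> 0]); last exact: open_neq0.
    by move=> z _; exact: continuous_rsubmx.
  have oL : open [set z : 'rV[R]_(n + n) | P (lsubmx z)].
    by apply: (@open_comp _ _ lsubmx P) => // z _; exact: continuous_lsubmx.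
  exact: openI oL oN.
have sl : smooth_on O (lsubmx : 'rV[R]_(n + n) -> 'rV[R]_n).
  by apply: smooth_on_linear => //; [exact: lsubmx_linear|exact: continuous_lsubmx].
have sr : smooth_on O (rsubmx : 'rV[R]_(n + n) -> 'rV[R]_n).
  by apply: smooth_on_linear => //; [exact: rsubmx_linear|exact: continuous_rsubmx].
have OP z : O z -> P (lsubmx z) by case.
exists (fun z => row_mx (h (lsubmx z)) ('D_(rsubmx z) h (lsubmx z))).
  rewrite slit_overlap_image//; apply: smooth_on_row => // j.
  case: (split_ordP j) => k ->; first last.
    apply: (@smooth_on_ext _ _ _ _ (fun z => \sum_i (rsubmx z) ord0 i *
        ('D_(delta_mx 0 i) h (lsubmx z)) ord0 k)).
      move=> z /OP Pz; rewrite row_mxEr (derive_row_sum _ (smooth_on_differentiable hs Pz)).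
      by rewrite summxE; apply: eq_bigr => i _; rewrite [RHS]mxE.
    split=> // l; apply: Ck_sum => // i.
    suff : smooth_on O (fun z : 'rV[R]_(n + n) => (rsubmx z) ord0 i *
        ('D_(delta_mx 0 i) h (lsubmx z)) ord0 k) by case=> _; apply.
    apply: smooth_onM; first exact: (smooth_on_coord i sr).
    exact: (smooth_on_coord k (smooth_on_comp_row (smooth_on_derive _ hs) sl OP)).
  apply: (@smooth_on_ext _ _ _ _ (fun z => h (lsubmx z) ord0 k)).
    by move=> z _; rewrite row_mxEl.
  exact: (smooth_on_coord k (smooth_on_comp_row hs sl OP)).
move=> u [su au] [_ bu].
rewrite !slit_chartE row_mxKl row_mxKr -hE//; congr row_mx.
have Pu : P (coord a u.1) by exists u.1.
have dh := smooth_on_differentiable hs Pu.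
apply/rowP => j; rewrite mxE (slit_vec_coordE Aa au su).
rewrite chart_vecE; last exact: smooth_near_coord.
rewrite derive_coord//; apply: near_eq_derive.
have nP : \forall z \near coord a u.1, P z by apply: open_nbhs_nbhs.
by apply: filterS nP => _ [x [ax bx] <-]; rewrite (local_repE gM)// hE.
Qed.

End Slit.

(** * Projection and vertical lift in bundle coordinates *)

Section SlitCalculus.
Context {R : realType} {n : nat} {M : manifold R n}.

Notation vec := ((M -> R) -> R).
Notation TM := (M * vec)%type.
Notation vecT := ((TM -> R) -> R).
Notation AM := (atlas M).
Notation SM := (slit_atlas M).
Implicit Types (c : chart R n M) (u w : TM) (xi : vecT) (s : TM -> vec) (D : connection M).
Let gM := atlas_compatible M.
Let gS := slit_compatible M.

Definition coord_field c (z : 'rV[R]_(n + n)) : TM -> vecT :=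
  chart_vec SM (slit_chart c) z.

(** In the chart [c] the components of this section are constant, both along the
    base and along the fibres. These sections replace a local frame, and turn
    identities between tensors into identities between derivatives. *)
Definition cst_section c (v : 'rV[R]_n) : TM -> vec :=
  fun u => chart_vec AM c v u.1.

Lemma cst_sectionE c v u : cst_section c v u = chart_vec AM c v u.1.
Proof. by []. Qed.

Lemma slit_atlasE c : AM c -> SM (slit_chart c).
Proof. by move=> Ac; exists c. Qed.
Local Hint Resolve slit_atlasE : core.

Lemma near_pt_fst u (P : M -> Prop) : slit M u -> near_pt AM u.1 P ->
  near_pt SM u (fun w => P w.1).
Proof.
move=> su /(near_pt_open _ _)[c [U [Ac cu oU Uu UP]]]; apply/(near_pt_open _ _).
exists (slit_chart c), [set z | U (lsubmx z)]; split=> //.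
- exact: slit_atlasE.
- by apply: (@open_comp _ _ lsubmx U) => // z _; exact: continuous_lsubmx.
- by rewrite slit_chartE /= row_mxKl.
by move=> w [sw cw]; rewrite slit_chartE /= row_mxKl; exact: UP.
Qed.

Lemma slit_in_slit_chart u : slit M u -> exists2 c, AM c & dom (slit_chart c) u.
Proof. by move=> su; have [c Ac cu] := slit_in_chart su; exists c. Qed.

Lemma slit_open u : slit M u -> near_pt SM u (slit M).
Proof.
move=> su; have [c Ac cu] := slit_in_slit_chart su.
have : near_pt SM u (dom (slit_chart c)) by apply: near_pt_dom => //; exact: slit_atlasE.
by apply: near_ptW => w [].
Qed.

Lemma cst_section_tangent c v u : AM c -> dom (slit_chart c) u ->
  tangent AM u.1 (cst_section c v u).
Proof. by move=> Ac [_ cu]; exact: tangent_chart_vec. Qed.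

Lemma tangent_cst_section c u X : AM c -> dom (slit_chart c) u ->
  tangent AM u.1 X -> exists v, X = cst_section c v u.
Proof. by move=> Ac [_ cu] /(tangentP gM _ Ac cu). Qed.

Lemma cst_section_lin c a v v' u : AM c -> dom (slit_chart c) u ->
  cst_section c (a *: v + v') u = a *: cst_section c v u + cst_section c v' u.
Proof. by move=> Ac [_ cu]; exact: chart_vec_linear. Qed.

Lemma cst_section0 c u : AM c -> dom (slit_chart c) u -> cst_section c 0 u = 0.
Proof. by move=> Ac [_ cu]; exact: (chart_vec0 gM). Qed.

Lemma cst_section_sum c v u : AM c -> dom (slit_chart c) u ->
  cst_section c v u = \sum_j v ord0 j *: cst_section c (delta_mx 0 j) u.
Proof. by move=> Ac [_ cu]; exact: (chart_vec_sum gM). Qed.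

Lemma coord_field_tangent c z u : AM c -> dom (slit_chart c) u ->
  tangent SM u (coord_field c z u).
Proof. by move=> Ac cu; apply: (tangent_chart_vec gS _ _ cu); exact: slit_atlasE. Qed.

Lemma coord_field_comm c z z' u (f : TM -> R) : AM c -> dom (slit_chart c) u ->
  smooth_near SM u f -> coord_field c z u (fun w => coord_field c z' w f) =
  coord_field c z' u (fun w => coord_field c z w f).
Proof. by move=> Ac scu; exact: (chart_vec_comm gS _ _ (slit_atlasE Ac) scu). Qed.

Lemma tangent_coord_field c u xi : AM c -> dom (slit_chart c) u ->
  tangent SM u xi -> exists z, xi = coord_field c z u.
Proof. by move=> /slit_atlasE Ac cu /(tangentP gS _ Ac cu). Qed.

Lemma smooth_near_fst u (f : M -> R) : slit M u -> smooth_near AM u.1 f ->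
  smooth_near SM u (fun w => f w.1).
Proof.
move=> su fu; have [c Ac cu] := slit_in_chart su.
have [U [Uu Uc fU]] := (smooth_nearP gM f Ac cu).1 fu.
have oU : open U by case: fU.
have oL : open [set z : 'rV[R]_(n + n) | U (lsubmx z)].
  by apply: (@open_comp _ _ lsubmx U) => // z _; exact: continuous_lsubmx.
have sl : smooth_on [set z : 'rV[R]_(n + n) | U (lsubmx z)]
    (lsubmx : 'rV[R]_(n + n) -> 'rV[R]_n).
  by apply: smooth_on_linear => //; [exact: lsubmx_linear|exact: continuous_lsubmx].
exists (slit_chart c), [set z | U (lsubmx z)], (local_rep c f \o lsubmx).
split=> //; first exact: slit_atlasE.
- by rewrite slit_chartE /= row_mxKl.
- exact: (smooth_on_comp fU sl).
by move=> w [sw cw] _; rewrite slit_chartE /= row_mxKl (local_repE gM).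
Qed.

Lemma rho_lin u a xi xi' : rho u (a *: xi + xi') = a *: rho u xi + rho u xi'.
Proof.
apply/funext => f; rewrite /rho /normalize !fctE.
by case: ifP => // _; rewrite scaler0 addr0.
Qed.

Lemma rhoE u xi f : smooth_near AM u.1 f -> rho u xi f = xi (fun w => f w.1).
Proof. by move=> fu; rewrite /rho /normalize asboolT. Qed.

Lemma rho_coord_field c z u : AM c -> dom (slit_chart c) u ->
  rho u (coord_field c z u) = cst_section c (lsubmx z) u.
Proof.
move=> Ac scu; have [su cu] := scu; apply/funext => f.
have [fu|nfu] := pselect (smooth_near AM u.1 f); last first.
  by rewrite /cst_section chart_vec_nonsmooth// /rho /normalize asboolF.
rewrite rhoE// /coord_field /cst_section !chart_vecE//; last exact: smooth_near_fst.
have dl := is_diff_linear (coord (slit_chart c) u) (@lsubmx_linear R n n)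
  (@continuous_lsubmx R 1 n n).
have E : lsubmx (coord (slit_chart c) u) = coord c u.1 by rewrite slit_chartE row_mxKl.
have df : differentiable (local_rep c f) (lsubmx (coord (slit_chart c) u)).
  by rewrite E; exact: (smooth_near_differentiable gM Ac cu fu).
transitivity ('D_z (local_rep c f \o lsubmx) (coord (slit_chart c) u)).
  apply: near_eq_derive; have Asc := slit_atlasE Ac.
  have nc : \forall y \near coord (slit_chart c) u, chart_image (slit_chart c) y.
    by apply: open_nbhs_nbhs; split; [exact: (open_chart_image gS Asc)|exact: chart_imageE].
  apply: filterS nc => _ [w cw <-] /=; rewrite (local_repE gS)//.
  by case: cw => _ cw; rewrite row_mxKl (local_repE gM).
rewrite derive_comp; [|exact: ex_diff|exact: df].
by rewrite [X in 'D_X _ _]deriveE ?diff_val ?E//; exact: ex_diff.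
Qed.

Lemma rho_tangent u xi : slit M u -> tangent SM u xi -> tangent AM u.1 (rho u xi).
Proof.
move=> su; have [c Ac cu] := slit_in_slit_chart su.
move=> /(tangent_coord_field Ac cu)[z ->].
by rewrite rho_coord_field//; exact: cst_section_tangent.
Qed.

(** Being nonzero is an open condition on the fibre coordinates, so the affine
    curve stays in the slit bundle for small parameters. *)
Lemma gamma_curve c v u : AM c -> dom (slit_chart c) u ->
  \forall t \near (0 : R),
    dom (slit_chart c) (u.1, u.2 + t *: cst_section c v u) /\
    coord (slit_chart c) (u.1, u.2 + t *: cst_section c v u) =
    coord (slit_chart c) u + t *: row_mx 0 v.
Proof.
move=> Ac [su cu].
have cl : {for (0 : R), continuous (fun t : R => fiber_coord c u + t *: v)}.
  apply: (@cvgD _ _ _ _ _ (cst (fiber_coord c u)) (fun t : R => t *: v)).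
    exact: cvg_cst.
  exact: scalel_continuous.
have f0 : fiber_coord c u + (0 : R) *: v <> 0.
  rewrite scale0r addr0 => E; case: (su) => _; apply.
  by rewrite (slit_vec_coordE Ac cu su) E (chart_vec0 gM).
have nz : nbhs (fiber_coord c u + (0 : R) *: v) [set y | y <> 0].
  by apply: open_nbhs_nbhs; split=> //; exact: open_neq0.
have nt : \forall t \near (0 : R), fiber_coord c u + t *: v <> 0 := cl _ nz.
apply: filterS nt => t t0.
have E : u.2 + t *: cst_section c v u =
    chart_vec AM c (fiber_coord c u + t *: v) u.1.
  rewrite {1}(slit_vec_coordE Ac cu su) [in RHS]addrC (chart_vec_linear gM)//.
  by rewrite addrC.
rewrite E; split; first by split=> //; exact: slit_chart_vec.
rewrite !slit_chartE /= fiber_coord_chart_vec//.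
by rewrite scale_row_mx add_row_mx scaler0 addr0.
Qed.

Lemma gamma_cst_section c v u : AM c -> dom (slit_chart c) u ->
  gamma u (cst_section c v u) = coord_field c (row_mx 0 v) u.
Proof.
move=> Ac cu; rewrite /gamma /coord_field.
rewrite -[X in chart_vec _ _ X](derive_affine_line (coord (slit_chart c) u)).
have slT := smooth_on_line (coord (slit_chart c) u) (row_mx 0 v) (@openT R).
have dl := smooth_on_differentiable slT (I : setT (0 : R)).
apply: (velocity_chart gS (slit_atlasE Ac) cu _ dl).
  by rewrite scale0r addr0 -surjective_pairing.
exact: gamma_curve.
Qed.

Lemma gamma_tangent u v : slit M u -> tangent AM u.1 v -> tangent SM u (gamma u v).
Proof.
move=> su; have [c Ac cu] := slit_in_slit_chart su.
move=> /(tangent_cst_section Ac cu)[z ->].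
by rewrite gamma_cst_section//; exact: coord_field_tangent.
Qed.

Lemma rho_gamma u v : slit M u -> tangent AM u.1 v -> rho u (gamma u v) = 0.
Proof.
move=> su; have [c Ac cu] := slit_in_slit_chart su.
move=> /(tangent_cst_section Ac cu)[z ->].
by rewrite gamma_cst_section// rho_coord_field// row_mxKl cst_section0.
Qed.

Lemma gamma_lin u a v v' : slit M u -> tangent AM u.1 v -> tangent AM u.1 v' ->
  gamma u (a *: v + v') = a *: gamma u v + gamma u v'.
Proof.
move=> su; have [c Ac cu] := slit_in_slit_chart su.
move=> /(tangent_cst_section Ac cu)[z ->] /(tangent_cst_section Ac cu)[z' ->].
transitivity (gamma u (cst_section c (a *: z + z') u)).
  by congr gamma; rewrite (cst_section_lin a z z' Ac cu).
rewrite (gamma_cst_section (a *: z + z') Ac cu) row_mx_linear0.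
apply: etrans (chart_vec_linear gS _ _ _ (slit_atlasE Ac) cu) _.
apply/esym; congr (a *: _ + _); exact: gamma_cst_section.
Qed.

(** In bundle coordinates [rho] forgets exactly the fibre components. *)
Lemma rho_eq0 u xi : slit M u -> tangent SM u xi -> rho u xi = 0 ->
  exists2 v, tangent AM u.1 v & xi = gamma u v.
Proof.
move=> su; have [c Ac scu] := slit_in_slit_chart su; have [_ cu] := scu.
move=> /(tangent_coord_field Ac scu)[z ->].
rewrite rho_coord_field// => /(chart_vec_eq0 Ac cu) z0.
exists (cst_section c (rsubmx z) u); first exact: cst_section_tangent.
by rewrite (gamma_cst_section _ Ac scu) -z0 hsubmxK.
Qed.

(** * Sections of the pullback bundle *)

Definition section_coord c s (j : 'I_n) : TM -> R :=
  fun w => s w (fun x => coord c x ord0 j).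

Notation frame c j := (cst_section c (delta_mx 0 j)).

Lemma section_coord_smooth c u s j : AM c -> dom (slit_chart c) u ->
  section_near u s -> smooth_near SM u (section_coord c s j).
Proof. by move=> Ac [_ cu] [_]; apply; exact: smooth_near_coord. Qed.

Lemma section_frameE c u s : AM c -> dom (slit_chart c) u -> section_near u s ->
  near_pt SM u (fun w => s w = \sum_j section_coord c s j w *: frame c j w).
Proof.
move=> Ac cu [ts _].
apply: near_ptW (near_ptI gS ts (near_pt_dom (slit_atlasE Ac) cu)) => w [tw [_ cw]].
rewrite [LHS](tangent_coordE gM Ac cw tw) (chart_vec_sum gM)//.
by apply: eq_bigr => j _; rewrite mxE.
Qed.

Lemma section_near_ext u s s' : near_pt SM u (fun w => s w = s' w) ->
  section_near u s -> section_near u s'.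
Proof.
move=> ss [ts fs]; split.
  by apply: near_ptW (near_ptI gS ss ts) => w [<-].
move=> f fu; apply: smooth_near_ext (fs f fu) => //.
by apply: near_ptW ss => w ->.
Qed.

Lemma cst_section_near c v u : AM c -> dom (slit_chart c) u ->
  section_near u (cst_section c v).
Proof.
move=> Ac cu; split.
  by apply: near_ptW (near_pt_dom (slit_atlasE Ac) cu) => w cw; exact: cst_section_tangent.
move=> f fu; apply: (@smooth_near_fst u (fun x => chart_vec AM c v x f)).
  by case: cu.
by case: cu => _ cu; exact: smooth_near_chart_vec.
Qed.

Lemma section_near_tangent u s : section_near u s -> tangent AM u.1 (s u).
Proof. by move=> [ts _]; exact: (near_pt_self ts). Qed.

Lemma rho_section_near u (Y : TM -> vecT) : slit M u -> vfield_near SM u Y ->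
  section_near u (fun w => rho w (Y w)).
Proof.
move=> su [tY sY]; split.
  by apply: near_ptW (near_ptI gS tY (slit_open su)) => w [tw sw]; exact: rho_tangent.
move=> f fu; apply: (smooth_near_ext gS (f := fun w => Y w (fun x => f x.1))).
  apply: near_ptW (near_pt_fst su (near_pt_smooth fu)) => w fw.
  by rewrite (rhoE _ fw).
by apply: sY; exact: smooth_near_fst.
Qed.

Lemma vfield_near_tangent u (X : TM -> vecT) : vfield_near SM u X -> tangent SM u (X u).
Proof. by move=> [tX _]; exact: (near_pt_self tX). Qed.

Lemma section_nearD u s s' : section_near u s -> section_near u s' ->
  section_near u (fun w => s w + s' w).
Proof.
move=> [ts fs] [ts' fs']; split; last by move=> f fu; apply: smooth_nearD; auto.
by apply: near_ptW (near_ptI gS ts ts') => w [tw tw']; exact: tangent_add.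
Qed.

Lemma section_nearZ u (F : TM -> R) s : smooth_near SM u F -> section_near u s ->
  section_near u (fun w => F w *: s w).
Proof.
move=> Fu [ts fs]; split; last by move=> f fu; apply: smooth_nearM; auto.
by apply: near_ptW ts => w tw; exact: tangentZ.
Qed.

Lemma section_near_sum c u I (r : seq I) (s : I -> TM -> vec) :
  AM c -> dom (slit_chart c) u -> (forall i, section_near u (s i)) ->
  section_near u (fun w => \sum_(i <- r) s i w).
Proof.
move=> Ac cu su; elim: r => [|i r IHr].
  under eq_fun do rewrite big_nil.
  apply: section_near_ext (cst_section_near 0 Ac cu).
  apply: near_ptW (near_pt_dom (slit_atlasE Ac) cu) => w cw.
  exact: cst_section0.
by under eq_fun do rewrite big_cons; exact: section_nearD.
Qed.

Lemma eta_near u : slit M u -> section_near u (@eta R n M).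
Proof.
move=> su; have [c Ac scu] := slit_in_slit_chart su.
have cE j : near_pt SM u (fun w =>
    coord (slit_chart c) w ord0 (rshift n j) = section_coord c (@eta R n M) j w).
  apply: near_ptW (near_pt_dom (slit_atlasE Ac) scu) => w _.
  by rewrite slit_chartE row_mxEr mxE.
have sE j : smooth_near SM u (section_coord c (@eta R n M) j).
  apply: smooth_near_ext (cE j) _ => //.
  by apply: smooth_near_coord => //; exact: slit_atlasE.
apply: (@section_near_ext _ (fun w => \sum_j section_coord c (@eta R n M) j w *: frame c j w)).
  apply: near_ptW (near_pt_dom (slit_atlasE Ac) scu) => w [sw cw].
  rewrite [RHS](slit_vec_coordE Ac cw sw) (chart_vec_sum gM)//.
  by apply: eq_bigr => j _; rewrite [in RHS]mxE.
by apply: (section_near_sum _ Ac scu) => j; apply: section_nearZ => //; exact: cst_section_near.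
Qed.

(** * Linear connections *)

Section Connection.
Variable D : connection M.
Hypothesis hD : linear_connection D.

Lemma conn_tangent u xi s : slit M u -> tangent SM u xi -> section_near u s ->
  tangent AM u.1 (D u xi s).
Proof. by case: hD => + _ _ _ _; apply. Qed.

Lemma conn_lin u a xi xi' s : slit M u -> tangent SM u xi -> tangent SM u xi' ->
  section_near u s -> D u (a *: xi + xi') s = a *: D u xi s + D u xi' s.
Proof. by case: hD => _ + _ _ _; apply. Qed.

Lemma connD u xi s s' : slit M u -> tangent SM u xi ->
  section_near u s -> section_near u s' ->
  D u xi (fun w => s w + s' w) = D u xi s + D u xi s'.
Proof. by case: hD => _ _ + _ _; apply. Qed.

Lemma conn_leibniz u xi F s : slit M u -> tangent SM u xi ->
  smooth_near SM u F -> section_near u s ->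
  D u xi (fun w => F w *: s w) = xi F *: s u + F u *: D u xi s.
Proof. by case: hD => _ _ _ + _; apply. Qed.

(** A section vanishing near [u] is its own product with the indicator of its
    support, a function that is smooth near [u]. *)
Lemma conn_near0 u xi s : slit M u -> tangent SM u xi ->
  near_pt SM u (fun w => s w = 0) -> D u xi s = 0.
Proof.
move=> su txi s0; have [c Ac scu] := slit_in_slit_chart su.
pose F w : R := if `[< s w = 0 >] then 0 else 1.
have Fs : s = (fun w => F w *: s w).
  apply/funext => w; rewrite /F; case: asboolP => [->|_]; first by rewrite scaler0.
  by rewrite scale1r.
have F0 : near_pt SM u (fun w => 0 = F w).
  by apply: near_ptW s0 => w sw; rewrite /F asboolT.
have Fsm : smooth_near SM u F.
  exact: (smooth_near_ext gS F0 (smooth_near_cst 0 (slit_atlasE Ac) scu)).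
have ssec : section_near u s.
  apply: section_near_ext (cst_section_near 0 Ac scu).
  apply: near_ptW (near_ptI gS s0 (near_pt_dom (slit_atlasE Ac) scu)) => w [-> cw].
  exact: cst_section0.
rewrite [in LHS]Fs conn_leibniz// (near_pt_self s0) scaler0 add0r.
by rewrite -(near_pt_self F0) scale0r.
Qed.

(** The axioms of a connection do not mention germs: locality follows from the
    Leibniz rule. *)
Lemma conn_near_eq u xi s s' : slit M u -> tangent SM u xi -> section_near u s ->
  near_pt SM u (fun w => s w = s' w) -> D u xi s = D u xi s'.
Proof.
move=> su txi us ss; have us' := section_near_ext ss us.
have [c Ac scu] := slit_in_slit_chart su.
have um : section_near u (fun w => -1 *: s w).
  by apply: section_nearZ us; exact: smooth_near_cst (slit_atlasE Ac) scu.
have ud := section_nearD us' um.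
have d0 : near_pt SM u (fun w => s' w + -1 *: s w = 0).
  by apply: near_ptW ss => w ->; rewrite scaleN1r subrr.
have sE : s' = (fun w => s w + (s' w + -1 *: s w)).
  by apply/funext => w; rewrite addrCA scaleN1r subrr addr0.
by rewrite [in RHS]sE connD// (conn_near0 su txi d0) addr0.
Qed.

Lemma conn_sum c u xi I (r : seq I) (s : I -> TM -> vec) : AM c -> dom (slit_chart c) u ->
  tangent SM u xi -> (forall i, section_near u (s i)) ->
  D u xi (fun w => \sum_(i <- r) s i w) = \sum_(i <- r) D u xi (s i).
Proof.
move=> Ac scu txi us; have [su _] := scu; elim: r => [|i r IHr].
  rewrite big_nil; apply: conn_near0 => //.
  apply: near_ptW (near_pt_dom (slit_atlasE Ac) scu) => w _.
  by rewrite big_nil.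
under eq_fun do rewrite big_cons.
by rewrite big_cons -IHr connD//; exact: section_near_sum Ac scu us.
Qed.

Lemma conn_frame c u xi s : AM c -> dom (slit_chart c) u -> tangent SM u xi ->
  section_near u s -> D u xi s = \sum_j (xi (section_coord c s j) *: frame c j u
    + section_coord c s j u *: D u xi (frame c j)).
Proof.
move=> Ac scu txi us; have [su _] := scu.
rewrite (conn_near_eq su txi us (section_frameE Ac scu us)).
have sm j := section_coord_smooth j Ac scu us.
have uf j := cst_section_near (delta_mx 0 j) Ac scu.
rewrite (conn_sum _ Ac scu txi); last by move=> j; exact: section_nearZ.
by apply: eq_bigr => j _; rewrite conn_leibniz.
Qed.

Lemma conn_cst_section_lin c u xi a v v' : AM c -> dom (slit_chart c) u ->
  tangent SM u xi -> D u xi (cst_section c (a *: v + v')) =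
  a *: D u xi (cst_section c v) + D u xi (cst_section c v').
Proof.
move=> Ac scu txi; have [su _] := scu.
have uv z := cst_section_near z Ac scu.
have sa := smooth_near_cst a (slit_atlasE Ac) scu.
have uav := section_nearZ sa (uv v).
have E : near_pt SM u (fun w => cst_section c (a *: v + v') w =
    a *: cst_section c v w + cst_section c v' w).
  by apply: near_ptW (near_pt_dom (slit_atlasE Ac) scu) => w cw; exact: cst_section_lin.
rewrite (conn_near_eq su txi (uv _) E) (connD su txi uav (uv v')).
rewrite (conn_leibniz su txi sa (uv v)).
by rewrite (tangent_cst gS a txi) scale0r add0r.
Qed.

Lemma conn_gamma_lin u a X Y s :
  slit M u -> tangent AM u.1 X -> tangent AM u.1 Y -> section_near u s ->
  D u (gamma u (a *: X + Y)) s = a *: D u (gamma u X) s + D u (gamma u Y) s.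
Proof.
move=> su tX tY us; rewrite (gamma_lin a su tX tY).
exact: (conn_lin a su (gamma_tangent su tX) (gamma_tangent su tY) us).
Qed.

Lemma conn_gamma0 u s :
  slit M u -> section_near u s -> D u (gamma u 0) s = 0.
Proof.
move=> su us; have [c Ac cu] := slit_in_chart su; have t0 := tangent0 gM Ac cu.
have := conn_gamma_lin (-1) su t0 t0 us.
by rewrite scaler0 addr0 scaleN1r addNr.
Qed.

Lemma conn_gammaZ u a X s :
  slit M u -> tangent AM u.1 X -> section_near u s ->
  D u (gamma u (a *: X)) s = a *: D u (gamma u X) s.
Proof.
move=> su tX us; have [c Ac cu] := slit_in_chart su; have t0 := tangent0 gM Ac cu.
have := conn_gamma_lin a su tX t0 us.
by rewrite addr0 (conn_gamma0 su us) addr0.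
Qed.

End Connection.

(** In the expansion of [conn_frame] the derivatives of the components of the
    section are the same for both connections, and cancel. *)
Lemma conn_sub_tensorial D D' u xi s s' : linear_connection D -> linear_connection D' ->
  slit M u -> tangent SM u xi -> section_near u s -> section_near u s' ->
  s u = s' u -> D u xi s - D' u xi s = D u xi s' - D' u xi s'.
Proof.
move=> hD hD' su txi us us' E; have [c Ac scu] := slit_in_slit_chart su.
rewrite !(@conn_frame _ _ c)// -!sumrB; apply: eq_bigr => j _.
have -> : section_coord c s j u = section_coord c s' j u by rewrite /section_coord E.
rewrite [X in X - _ = _]addrC addrKA [X in _ = X - _]addrC addrKA.
by [].
Qed.

End SlitCalculus.

(** * Fields along the fibres *)

#[local] Opaque chart_vec tangent smooth_near section_near near_pt.

Lemma is_derive_square_shift (R : realType) (a : R) :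
  is_derive (0 : R) 1 (fun t : R => (1 + t) ^+ 2 * a) (2 * a).
Proof.
have -> : (fun t : R => (1 + t) ^+ 2 * a) = ((cst 1 + id : R -> R) ^+ 2 * cst a).
  by apply/funext => t; rewrite !fctE.
apply: is_derive_eq; rewrite !fctE.
rewrite addr0 expr1 scaler0 !add0r.
change (a * (2 * 1 * 1) = 2 * a); by rewrite !mulr1 mulrC.
Qed.

Section FinslerMetric.
Context {R : realType} {n : nat} {M : manifold R n}.

Notation vec := ((M -> R) -> R).
Notation TM := (M * vec)%type.
Notation vecT := ((TM -> R) -> R).
Notation AM := (atlas M).
Notation SM := (slit_atlas M).
Implicit Types (c : chart R n M) (u w : TM) (xi : vecT) (s : TM -> vec).
Let gM := atlas_compatible M.
Let gS := slit_compatible M.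

Definition fiber_field c (v : 'rV[R]_n) : TM -> vecT := coord_field c (row_mx 0 v).

Lemma fiber_fieldE c v u : fiber_field c v u = coord_field c (row_mx 0 v) u.
Proof. by []. Qed.

Lemma gamma_fiber_field c v u : AM c -> dom (slit_chart c) u ->
  gamma u (cst_section c v u) = fiber_field c v u.
Proof. exact: gamma_cst_section. Qed.

Lemma fiber_field_tangent c v u : AM c -> dom (slit_chart c) u ->
  tangent SM u (fiber_field c v u).
Proof. exact: coord_field_tangent. Qed.

Lemma rho_fiber_field c v u : AM c -> dom (slit_chart c) u ->
  rho u (fiber_field c v u) = 0.
Proof. by move=> Ac scu; rewrite rho_coord_field// row_mxKl cst_section0. Qed.

Lemma fiber_field_lin c a v v' u : AM c -> dom (slit_chart c) u ->
  fiber_field c (a *: v + v') u = a *: fiber_field c v u + fiber_field c v' u.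
Proof.
move=> Ac scu; rewrite /fiber_field row_mx_linear0.
exact: (chart_vec_linear gS _ _ _ (slit_atlasE Ac) scu).
Qed.

Lemma fiber_field0 c u : AM c -> dom (slit_chart c) u -> fiber_field c 0 u = 0.
Proof.
move=> Ac scu; rewrite /fiber_field row_mx0.
exact: (chart_vec0 gS (slit_atlasE Ac) scu).
Qed.

Lemma fiber_field_sum c v u : AM c -> dom (slit_chart c) u ->
  fiber_field c v u = \sum_j v ord0 j *: fiber_field c (delta_mx 0 j) u.
Proof.
move=> Ac scu; rewrite [in LHS](row_sum_delta v).
elim/big_rec2: _ => [|j x y _ E]; first exact: fiber_field0.
by rewrite fiber_field_lin// E.
Qed.

Lemma fiber_field_smooth c v u (f : TM -> R) : AM c -> dom (slit_chart c) u ->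
  smooth_near SM u f -> smooth_near SM u (fun w => fiber_field c v w f).
Proof. by move=> Ac scu; exact: (smooth_near_chart_vec gS _ (slit_atlasE Ac) scu). Qed.

Lemma fiber_field_comm c v v' u (f : TM -> R) : AM c -> dom (slit_chart c) u ->
  smooth_near SM u f -> fiber_field c v u (fun w => fiber_field c v' w f) =
  fiber_field c v' u (fun w => fiber_field c v w f).
Proof. by move=> Ac scu; exact: (chart_vec_comm gS _ _ (slit_atlasE Ac) scu). Qed.

Lemma tangent_dom_eq c u xi (f g : TM -> R) : AM c -> dom (slit_chart c) u ->
  tangent SM u xi -> (forall w, dom (slit_chart c) w -> f w = g w) -> xi f = xi g.
Proof.
move=> Ac scu txi fg; apply: (tangent_near_eq gS txi).
by apply: near_ptW (near_pt_dom (slit_atlasE Ac) scu).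
Qed.

Lemma fiber_field_coord c v u j : AM c -> dom (slit_chart c) u ->
  fiber_field c v u (fun w => fiber_coord c w ord0 j) = v ord0 j.
Proof.
move=> Ac scu.
transitivity (fiber_field c v u
    (fun w => coord (slit_chart c) w ord0 (rshift n j))).
  apply: (tangent_dom_eq Ac scu (fiber_field_tangent v Ac scu)) => w _.
  by rewrite slit_chartE row_mxEr.
rewrite [LHS](chart_vec_coord gS _ _ (slit_atlasE Ac) scu).
by rewrite row_mxEr.
Qed.

#[local] Opaque cst_section coord_field.

Lemma derive1_gamma u v (f : TM -> R) : smooth_near SM u f ->
  derive1 (fun t : R => f (u.1, u.2 + t *: v)) 0 = gamma u v f.
Proof.
move=> fu; rewrite /gamma /velocity scale0r addr0 -surjective_pairing.
by rewrite /normalize asboolT.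
Qed.

#[local] Opaque fiber_field.

(** * Homogeneity along the fibres *)

Definition euler_field c w : vecT := fiber_field c (fiber_coord c w) w.

Lemma fiber_coord_smooth c u j : AM c -> dom (slit_chart c) u ->
  smooth_near SM u (fun w => fiber_coord c w ord0 j).
Proof.
move=> Ac scu.
apply: (smooth_near_ext gS) (smooth_near_coord (rshift n j) (slit_atlasE Ac) scu).
apply: near_ptW (near_pt_dom (slit_atlasE Ac) scu) => w _.
by rewrite slit_chartE row_mxEr.
Qed.

Lemma euler_fieldE c w (f : TM -> R) : AM c -> dom (slit_chart c) w ->
  euler_field c w f =
  \sum_j fiber_coord c w ord0 j * fiber_field c (delta_mx 0 j) w f.
Proof.
move=> Ac scw; rewrite /euler_field fiber_field_sum// fct_sumE.
by apply: eq_bigr.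
Qed.

(** The commutator of the radial field with a constant field of the fibre is minus
    this constant field, so differentiation lowers the degree of homogeneity
    by one. *)
Lemma euler_fiber_field c (f : TM -> R) (r : R) v : AM c ->
  (forall w, dom (slit_chart c) w -> smooth_near SM w f) ->
  (forall w, dom (slit_chart c) w -> euler_field c w f = r * f w) ->
  forall u, dom (slit_chart c) u ->
    euler_field c u (fun w => fiber_field c v w f) = (r - 1) * fiber_field c v u f.
Proof.
move=> Ac fs fE u scu; have tv := fiber_field_tangent v Ac scu.
have Asc := slit_atlasE Ac; have fu := fs _ scu.
have yS j := fiber_coord_smooth j Ac scu.
have fjS j := fiber_field_smooth (delta_mx 0 j) Ac scu fu.
have : fiber_field c v u (fun w => r * f w) = fiber_field c v u (fun w =>
    \sum_j fiber_coord c w ord0 j * fiber_field c (delta_mx 0 j) w f).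
  apply: (tangent_dom_eq Ac scu tv) => w scw.
  by rewrite -fE// euler_fieldE.
rewrite (tangentM gS tv (smooth_near_cst r Asc scu) fu) (tangent_cst gS r tv) mulr0 addr0.
rewrite (tangent_sum_fun gS _ Asc scu tv); last by move=> j; exact: smooth_nearM.
under eq_bigr => j _ do
  rewrite (tangentM gS tv (yS j) (fjS j)) (fiber_field_coord v j Ac scu)
    (fiber_field_comm v (delta_mx 0 j) Ac scu fu).
rewrite big_split /= -(euler_fieldE _ Ac scu) => E.
rewrite mulrBl mul1r E.
suff -> : \sum_(i < n) fiber_field c (delta_mx 0 i) u f * v ord0 i =
  fiber_field c v u f by rewrite addrK.
rewrite (fiber_field_sum v Ac scu) fct_sumE.
by apply: eq_bigr => j _; rewrite mulrC.
Qed.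

(** * The metric of a Finsler structure *)

Section Metric.
Variable L : TM -> R.
Hypothesis hL : finsler L.
Notation g := (finsler_metric L).
Notation energy := (fun w : TM => L w ^+ 2).

Lemma energy_smooth u : slit M u -> smooth_near SM u energy.
Proof.
move=> su; case: hL => /(_ u su) Lu _ _ _.
by apply: (smooth_nearM gS).
Qed.

(** The two derivatives that define the metric are those along the fibre, read as
    coordinate fields of the slit bundle. All differential properties of the
    metric are derived from this formula. *)
Lemma finsler_metricE c v v' u : AM c -> dom (slit_chart c) u ->
  g u (cst_section c v u) (cst_section c v' u) =
  2^-1 * fiber_field c v u (fun w => fiber_field c v' w energy).
Proof.
move=> Ac scu; have [su cu] := scu; rewrite /finsler_metric; congr (_ * _).
have fu := fiber_field_smooth v' Ac scu (energy_smooth su).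
rewrite -(gamma_fiber_field v Ac scu) -(derive1_gamma _ fu) !derive1E.
apply: near_eq_derive; have := gamma_curve v Ac scu; apply: filterS => s [scw _].
rewrite -(gamma_fiber_field v' Ac scw) -derive1_gamma//.
by apply: energy_smooth; case: scw.
Qed.

Lemma metric_cst_smooth c v v' u : AM c -> dom (slit_chart c) u ->
  smooth_near SM u (fun w => g w (cst_section c v w) (cst_section c v' w)).
Proof.
move=> Ac scu; have Asc := slit_atlasE Ac; have [su cu] := scu.
apply: (smooth_near_ext gS (f := fun w => 2^-1 * fiber_field c v w
    (fun w => fiber_field c v' w energy))).
  by apply: near_ptW (near_pt_dom Asc scu) => w scw; rewrite finsler_metricE.
apply: (smooth_nearM gS); first exact: smooth_near_cst Asc scu.
by do 2! apply: fiber_field_smooth => //; exact: energy_smooth.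
Qed.

#[local] Opaque finsler_metric.

Lemma metricC u v v' : slit M u -> tangent AM u.1 v -> tangent AM u.1 v' ->
  g u v v' = g u v' v.
Proof.
move=> su; have [c Ac scu] := slit_in_slit_chart su.
move=> /(tangent_cst_section Ac scu)[a ->] /(tangent_cst_section Ac scu)[b ->].
apply: etrans (finsler_metricE a b Ac scu) _.
apply: etrans _ (esym (finsler_metricE b a Ac scu)).
exact: (congr1 ( *%R 2^-1) (fiber_field_comm a b Ac scu (energy_smooth su))).
Qed.

Lemma metric_linl u a v v' z : slit M u -> tangent AM u.1 v -> tangent AM u.1 v' ->
  tangent AM u.1 z -> g u (a *: v + v') z = a * g u v z + g u v' z.
Proof.
move=> su; have [c Ac scu] := slit_in_slit_chart su.
move=> /(tangent_cst_section Ac scu)[x ->] /(tangent_cst_section Ac scu)[y ->].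
move=> /(tangent_cst_section Ac scu)[b ->].
have E := finsler_metricE (a *: x + y) b Ac scu.
rewrite (cst_section_lin a x y Ac scu) (fiber_field_lin a x y Ac scu) in E.
apply: etrans E _; rewrite !fctE mulrDr.
have Ex := finsler_metricE x b Ac scu; have Ey := finsler_metricE y b Ac scu.
by rewrite Ex Ey mulrCA.
Qed.

Lemma metric0l u z : slit M u -> tangent AM u.1 z -> g u 0 z = 0.
Proof.
move=> su tw; have [c Ac cu] := slit_in_chart su; have t0 := tangent0 gM Ac cu.
have := metric_linl (-1) su t0 t0 tw.
by rewrite scaler0 addr0 mulN1r addNr.
Qed.

Lemma metric0r u z : slit M u -> tangent AM u.1 z -> g u z 0 = 0.
Proof.
move=> su tw; have [c Ac cu] := slit_in_chart su; have t0 := tangent0 gM Ac cu.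
by rewrite metricC// metric0l.
Qed.

Lemma metricNl u v z : slit M u -> tangent AM u.1 v -> tangent AM u.1 z ->
  g u (- v) z = - g u v z.
Proof.
move=> su tv tz; have [c Ac cu] := slit_in_chart su.
rewrite -[- v]addr0 -scaleN1r (metric_linl _ su tv (tangent0 gM Ac cu) tz).
by rewrite (metric0l su tz) addr0 mulN1r.
Qed.

Lemma metricBl u X Y W : slit M u ->
  tangent AM u.1 X -> tangent AM u.1 Y -> tangent AM u.1 W ->
  g u (X - Y) W = g u X W - g u Y W.
Proof.
move=> su tX tY tW; have E := metric_linl (-1) su tY tX tW.
by rewrite scaleN1r mulN1r addrC [RHS]addrC in E.
Qed.

Lemma metric_comb u X Y Z W (r : R) : slit M u ->
  tangent AM u.1 X -> tangent AM u.1 Y -> tangent AM u.1 Z -> tangent AM u.1 W ->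
  g u (X - Y + r *: Z) W =
  g u X W - g u Y W + r * g u Z W.
Proof.
move=> su tX tY tZ tW; have tXY := tangent_sub gM tX tY.
rewrite addrC (metric_linl r su tZ tXY tW) [LHS]addrC; congr (_ + _).
exact: metricBl.
Qed.

Lemma metric_gt0 u v : slit M u -> tangent AM u.1 v -> v <> 0 -> 0 < g u v v.
Proof. by case: hL => _ _ _ gpos; exact: gpos. Qed.

Lemma metric_ge0 u v : slit M u -> tangent AM u.1 v -> 0 <= g u v v.
Proof.
move=> su tv; have [->|v0] := pselect (v = 0); last exact/ltW/metric_gt0.
by rewrite metric0l//; have [c Ac cu] := slit_in_chart su; exact: tangent0 Ac cu.
Qed.

Lemma metric_nondegenerate u v v' : slit M u -> tangent AM u.1 v -> tangent AM u.1 v' ->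
  (forall z, tangent AM u.1 z -> g u v z = g u v' z) -> v = v'.
Proof.
move=> su tv tv' E; apply/eqP; rewrite -subr_eq0; apply/eqP; apply: contrapT => nd.
have td := tangent_sub gM tv tv'.
have := metric_gt0 su td nd.
have dE : v - v' = -1 *: v' + v by rewrite scaleN1r addrC.
by rewrite [X in g u X]dE (metric_linl _ su tv' tv td) E// mulN1r addNr ltxx.
Qed.

(** The metric is bilinear, so it is a combination of its values on the constant
    sections with coefficients the components of [s] and [s']. *)
Lemma metric_smooth u s s' : slit M u -> section_near u s -> section_near u s' ->
  smooth_near SM u (fun w => g w (s w) (s' w)).
Proof.
move=> su us us'; have [c Ac scu] := slit_in_slit_chart su; have Asc := slit_atlasE Ac.
pose F w := \sum_i \sum_j section_coord c s i w * (section_coord c s' j w *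
  g w (cst_section c (delta_mx 0 i) w) (cst_section c (delta_mx 0 j) w)).
apply: (smooth_near_ext gS (f := F)); last first.
  apply: (smooth_near_sum gS _ Asc scu) => i.
  apply: (smooth_near_sum gS _ Asc scu) => j.
  apply: (smooth_nearM gS); first exact: section_coord_smooth.
  apply: (smooth_nearM gS); first exact: section_coord_smooth.
  exact: metric_cst_smooth.
have ns := section_frameE Ac scu us; have ns' := section_frameE Ac scu us'.
apply: near_ptW (near_ptI gS (near_ptI gS ns ns') (near_pt_dom Asc scu)).
move=> w [[-> ->] scw]; have [sw cw] := scw.
have tE (v : 'I_n -> R) k : tangent AM w.1 (\sum_(i <- k) v i *: cst_section c (delta_mx 0 i) w).
  apply: (tangent_sum gM _ Ac cw) => i; apply: (tangentZ gM).
  exact: cst_section_tangent.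
have linl (v : 'I_n -> R) X k : tangent AM w.1 X ->
  g w (\sum_(i <- k) v i *: cst_section c (delta_mx 0 i) w) X =
  \sum_(i <- k) v i * g w (cst_section c (delta_mx 0 i) w) X.
  move=> tX; elim: k => [|i k IHk]; first by rewrite !big_nil metric0l.
  by rewrite !big_cons metric_linl// ?IHk//; exact: cst_section_tangent.
rewrite /F; have te i := cst_section_tangent (delta_mx 0 i) Ac scw.
rewrite (linl _ _ _ (tE _ _)); apply: eq_bigr => i _.
rewrite (metricC sw (te i) (tE _ _)) (linl _ _ _ (te i)) mulr_sumr.
apply: eq_bigr => j _; have Eij := metricC sw (te i) (te j).
exact: (congr1 (fun r => section_coord c s i w * (section_coord c s' j w * r)) Eij).
Qed.

Lemma tangent_scale u xi (a : R) (f : TM -> R) : slit M u -> tangent SM u xi ->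
  smooth_near SM u f -> xi (fun w => a * f w) = a * xi f.
Proof.
move=> su txi fu; have [c Ac scu] := slit_in_slit_chart su.
rewrite (tangentM gS txi (smooth_near_cst a (slit_atlasE Ac) scu) fu).
by rewrite (tangent_cst gS a txi) mulr0 addr0.
Qed.

Lemma fiber_field_metricE c x v v' u : AM c -> dom (slit_chart c) u ->
  fiber_field c x u (fun w => g w (cst_section c v w) (cst_section c v' w)) =
  2^-1 * fiber_field c x u (fun w => fiber_field c v w
    (fun w => fiber_field c v' w energy)).
Proof.
move=> Ac scu; have [su _] := scu; have tx := fiber_field_tangent x Ac scu.
transitivity (fiber_field c x u (fun w => 2^-1 * fiber_field c v w
    (fun w => fiber_field c v' w energy))).
  by apply: (tangent_dom_eq Ac scu tx) => w scw; exact: finsler_metricE.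
have S1 := fiber_field_smooth v' Ac scu (energy_smooth su).
exact: (tangent_scale _ su tx (fiber_field_smooth v Ac scu S1)).
Qed.

(** The Cartan tensor, being a third derivative of the energy along the fibre,
    is totally symmetric. *)
Lemma fiber_field_metric_sym c x v v' u : AM c -> dom (slit_chart c) u ->
  fiber_field c x u (fun w => g w (cst_section c v w) (cst_section c v' w)) =
  fiber_field c v u (fun w => g w (cst_section c x w) (cst_section c v' w)).
Proof.
move=> Ac scu; have [su _] := scu; have S1 := fiber_field_smooth v' Ac scu (energy_smooth su).
apply: etrans (fiber_field_metricE x v v' Ac scu) _.
apply: etrans _ (esym (fiber_field_metricE v x v' Ac scu)).
exact: (congr1 ( *%R 2^-1) (fiber_field_comm x v Ac scu S1)).
Qed.

Lemma euler_energy c u : AM c -> dom (slit_chart c) u ->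
  euler_field c u energy = 2 * L u ^+ 2.
Proof.
move=> Ac scu; have [su cu] := scu; case: hL => _ _ homL _.
have yE : u.2 = cst_section c (fiber_coord c u) u by exact: slit_vec_coordE.
rewrite /euler_field -(gamma_fiber_field _ Ac scu) -yE -derive1_gamma; last first.
  exact: energy_smooth.
have d2 : is_derive (0 : R) 1 (fun t : R => (1 + t) ^+ 2 * L u ^+ 2) (2 * L u ^+ 2).
  exact: is_derive_square_shift.
rewrite derive1E; case: d2 => _ <-; apply: near_eq_derive.
have n1 : \forall t \near (0 : R), -1 < t.
  by apply: open_nbhs_nbhs; split; [exact: open_gt|rewrite /= ltrN10].
apply: filterS n1 => t t1; have t0 : 0 < 1 + t by rewrite -ltrBlDl sub0r.
by rewrite -[X in X + _]scale1r -scalerDl homL// exprMn.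
Qed.

(** By total symmetry the radial vector can be moved to the place of the
    direction of derivation; the metric is a second derivative of the energy,
    hence homogeneous of degree 0. *)
Lemma fiber_field_metric_eta c x v u : AM c -> dom (slit_chart c) u ->
  fiber_field c x u (fun w =>
    g w (cst_section c (fiber_coord c u) w) (cst_section c v w)) = 0.
Proof.
move=> Ac scu; have [su _] := scu.
apply: etrans (fiber_field_metric_sym x _ v Ac scu) _.
apply: etrans (fiber_field_metricE _ x v Ac scu) _.
have sE w : dom (slit_chart c) w -> smooth_near SM w energy.
  by case=> sw _; exact: energy_smooth.
have E1 := euler_fiber_field v Ac sE (fun w scw => euler_energy Ac scw).
have sE1 w : dom (slit_chart c) w ->
    smooth_near SM w (fun w => fiber_field c v w energy).
  by move=> scw; apply: fiber_field_smooth => //; exact: sE.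
have := euler_fiber_field x Ac sE1 E1 scu.
by rewrite -addrA -opprD subrr mul0r /euler_field => ->; rewrite mulr0.
Qed.

End Metric.
End FinslerMetric.

#[local] Opaque chart_vec tangent smooth_near section_near near_pt finsler_metric
  cst_section coord_field fiber_field.

(** * Cartan connections *)

Section Cartan.
Context {R : realType} {n : nat} {M : manifold R n}.

Notation vec := ((M -> R) -> R).
Notation TM := (M * vec)%type.
Notation vecT := ((TM -> R) -> R).
Notation AM := (atlas M).
Notation SM := (slit_atlas M).
Implicit Types (c : chart R n M) (u w : TM) (xi : vecT) (s : TM -> vec).
Let gM := atlas_compatible M.
Let gS := slit_compatible M.

Lemma rhoD u xi xi' : rho u (xi + xi') = rho u xi + rho u xi'.
Proof. by have := rho_lin u 1 xi xi'; rewrite !scale1r. Qed.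

Lemma rhoB u xi xi' : rho u (xi - xi') = rho u xi - rho u xi'.
Proof. by rewrite -scaleN1r addrC rho_lin scaleN1r addrC. Qed.

Lemma near_slit_dom c u : AM c -> dom (slit_chart c) u ->
  near_pt SM u (dom (slit_chart c)).
Proof. by move=> Ac scu; exact: near_pt_dom (slit_atlasE Ac) scu. Qed.

(** The bracket of two lifts of coordinate fields of the base projects to the
    bracket of these, which is zero. *)
Lemma rho_bracket0 c a b u (X Y : TM -> vecT) : AM c -> dom (slit_chart c) u ->
  near_pt SM u (fun w => tangent SM w (X w) /\ rho w (X w) = cst_section c a w) ->
  near_pt SM u (fun w => tangent SM w (Y w) /\ rho w (Y w) = cst_section c b w) ->
  rho u (bracket SM X Y u) = 0.
Proof.
move=> Ac scu nX nY; have [su cu] := scu; apply/funext => f.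
have [fu|nfu] := pselect (smooth_near AM u.1 f); last first.
  by rewrite /rho /normalize asboolF.
have fS := smooth_near_fst su fu.
have nf := near_pt_fst su (near_pt_smooth fu).
have lift (Z Z' : TM -> vecT) (z z' : 'rV[R]_n) :
    near_pt SM u (fun w => tangent SM w (Z w) /\ rho w (Z w) = cst_section c z w) ->
    near_pt SM u (fun w => tangent SM w (Z' w) /\ rho w (Z' w) = cst_section c z' w) ->
    Z u (fun w => Z' w (fun w => f w.1)) =
    chart_vec AM c z u.1 (fun x => chart_vec AM c z' x f).
  move=> nZ nZ'; have [tZ rZ] := near_pt_self nZ.
  have hs : smooth_near AM u.1 (fun x => chart_vec AM c z' x f).
    exact: smooth_near_chart_vec.
  transitivity (Z u (fun w => chart_vec AM c z' w.1 f)).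
    apply: (tangent_near_eq gS tZ).
    by apply: near_ptW (near_ptI gS nZ' nf) => w [[_ rw] fw]; rewrite -(rhoE _ fw) rw cst_sectionE.
  by rewrite -(rhoE _ hs) rZ cst_sectionE.
rewrite rhoE// /bracket /normalize asboolT// (lift X Y a b)// (lift Y X b a)//.
by rewrite (chart_vec_comm gM a b Ac cu fu) subrr.
Qed.

(** Lifts of constant sections have no bracket term. *)
Lemma torsion_coord (D : connection M) c a b u (X Y : TM -> vecT) :
  linear_connection D -> AM c -> dom (slit_chart c) u ->
  near_pt SM u (fun w => tangent SM w (X w) /\ rho w (X w) = cst_section c a w) ->
  near_pt SM u (fun w => tangent SM w (Y w) /\ rho w (Y w) = cst_section c b w) ->
  torsion D X Y u = D u (X u) (cst_section c b) - D u (Y u) (cst_section c a).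
Proof.
move=> hD Ac scu nX nY; have [su cu] := scu.
have [tX _] := near_pt_self nX; have [tY _] := near_pt_self nY.
rewrite /torsion (rho_bracket0 Ac scu nX nY) subr0; congr (_ - _); apply/esym.
  apply: (conn_near_eq hD su tX (cst_section_near b Ac scu)).
  by apply: near_ptW nY => w [_ ->].
apply: (conn_near_eq hD su tY (cst_section_near a Ac scu)).
by apply: near_ptW nX => w [_ ->].
Qed.

Section Regular.
Variable D : connection M.
Hypotheses (hD : linear_connection D) (rD : regular D).

(** Regularity splits any lift of [v] into a vertical vector and a vector of
    [kerK]; the latter is still a lift of [v]. *)
Lemma betaP u v : slit M u -> tangent AM u.1 v ->
  kerK D u (beta D u v) /\ rho u (beta D u v) = v.
Proof.
move=> su tv; have [c Ac scu] := slit_in_slit_chart su.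
rewrite /beta.
suff : exists xi, kerK D u xi /\ rho u xi = v.
  by move=> /(@xgetPex _ 0 [set xi | kerK D u xi /\ rho u xi = v]).
have [z vE] := tangent_cst_section Ac scu tv.
have txi := coord_field_tangent (row_mx z 0) Ac scu.
have [xi0 [h [[_ r0] kh xiE]]] := (rD su).1 _ txi.
exists h; split=> //; rewrite vE -[z](row_mxKl _ (0 : 'rV[R]_n)).
by rewrite -(rho_coord_field _ Ac scu) xiE rhoD r0 add0r.
Qed.

Lemma beta_tangent u v : slit M u -> tangent AM u.1 v -> tangent SM u (beta D u v).
Proof. by move=> su tv; have [[]] := betaP su tv. Qed.

Lemma rho_beta u v : slit M u -> tangent AM u.1 v -> rho u (beta D u v) = v.
Proof. by move=> su tv; have [] := betaP su tv. Qed.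

Lemma conn_beta_eta u v : slit M u -> tangent AM u.1 v -> D u (beta D u v) (@eta R n M) = 0.
Proof. by move=> su tv; have [[]] := betaP su tv. Qed.

Lemma near_beta c v u : AM c -> dom (slit_chart c) u ->
  near_pt SM u (fun w => tangent SM w (beta D w (cst_section c v w)) /\
    rho w (beta D w (cst_section c v w)) = cst_section c v w).
Proof.
move=> Ac scu; apply: near_ptW (near_slit_dom Ac scu) => w scw.
have tv := cst_section_tangent v Ac scw; have [sw _] := scw.
by split; [exact: beta_tangent|exact: rho_beta].
Qed.

Lemma near_gamma c v u : AM c -> dom (slit_chart c) u ->
  near_pt SM u (fun w => tangent SM w (gamma w (cst_section c v w)) /\
    rho w (gamma w (cst_section c v w)) = cst_section c 0 w).
Proof.
move=> Ac scu; apply: near_ptW (near_slit_dom Ac scu) => w scw.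
have tv := cst_section_tangent v Ac scw; have [sw _] := scw.
split; first exact: gamma_tangent.
by rewrite (rho_gamma sw tv) (cst_section0 Ac scw).
Qed.

Lemma torsionT_coord c x v u : AM c -> dom (slit_chart c) u ->
  torsionT D (cst_section c x) (cst_section c v) u =
  D u (gamma u (cst_section c x u)) (cst_section c v).
Proof.
move=> Ac scu; have [su _] := scu.
rewrite /torsionT (torsion_coord hD Ac scu (near_gamma x Ac scu) (near_beta v Ac scu)).
rewrite [X in _ - X](conn_near0 hD su) ?subr0//.
  by apply: beta_tangent => //; exact: cst_section_tangent.
by apply: near_ptW (near_slit_dom Ac scu) => w scw; exact: cst_section0.
Qed.

Lemma torsionQ_coord c v v' u : AM c -> dom (slit_chart c) u ->
  torsionQ D (cst_section c v) (cst_section c v') u =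
  D u (beta D u (cst_section c v u)) (cst_section c v') -
  D u (beta D u (cst_section c v' u)) (cst_section c v).
Proof.
by move=> Ac scu; exact: torsion_coord hD Ac scu (near_beta v Ac scu) (near_beta v' Ac scu).
Qed.

End Regular.

Section CartanConnection.
Variables (L : TM -> R) (D : connection M).
Hypotheses (hL : finsler L) (hC : cartan_connection L D).
Notation g := (finsler_metric L).

Let hD : linear_connection D. Proof. by case: hC. Qed.
Let rD : regular D. Proof. by case: hC. Qed.
Let mD : metric_connection L D. Proof. by case: hC. Qed.

Lemma fiber_conn_tangent c x v u : AM c -> dom (slit_chart c) u ->
  tangent AM u.1 (D u (fiber_field c x u) (cst_section c v)).
Proof.
move=> Ac scu; have [su _] := scu.
exact: (conn_tangent hD su (fiber_field_tangent x Ac scu) (cst_section_near v Ac scu)).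
Qed.

(** This is the condition on the torsion T, which reduces to one term on constant
    sections. *)
Lemma fiber_conn_sym c x v v' u : AM c -> dom (slit_chart c) u ->
  g u (D u (fiber_field c x u) (cst_section c v)) (cst_section c v' u) =
  g u (D u (fiber_field c x u) (cst_section c v')) (cst_section c v u).
Proof.
move=> Ac scu; have [su _] := scu; have ns z := cst_section_near z Ac scu.
case: hC => _ _ _ _ /(_ u _ _ _ su (ns x) (ns v) (ns v')).
have E1 := torsionT_coord hD rD x v Ac scu; have E2 := torsionT_coord hD rD x v' Ac scu.
by rewrite E1 E2 (gamma_fiber_field x Ac scu).
Qed.

(** Compatibility with the metric gives the sum of two terms exchanged by [v] and
    [v'], and these are equal by the condition on T. *)
Lemma metric_fiber_conn c x v v' u : AM c -> dom (slit_chart c) u ->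
  g u (D u (fiber_field c x u) (cst_section c v)) (cst_section c v' u) =
  2^-1 * fiber_field c x u (fun w => g w (cst_section c v w) (cst_section c v' w)).
Proof.
move=> Ac scu; have [su _] := scu.
have half (r : R) : r = 2^-1 * (r + r) by rewrite mulrDr !(mulrC 2^-1) -splitr.
have ns z := cst_section_near z Ac scu; have ts := cst_section_tangent v Ac scu.
have E := mD su (fiber_field_tangent x Ac scu) (ns v) (ns v').
have E2 := etrans (metricC hL su ts (fiber_conn_tangent x v' Ac scu))
  (esym (fiber_conn_sym x v v' Ac scu)).
exact: etrans (half _) (congr1 ( *%R 2^-1) (esym (etrans E (congr1 (+%R _) E2)))).
Qed.

Lemma fiber_conn_fiber_coord c x u : AM c -> dom (slit_chart c) u ->
  D u (fiber_field c x u) (cst_section c (fiber_coord c u)) = 0.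
Proof.
move=> Ac scu; have [su cu] := scu.
apply: (metric_nondegenerate hL su (fiber_conn_tangent _ _ Ac scu)).
  exact: tangent0 Ac cu.
move=> z tz; rewrite (metric0l hL su tz).
have [v ->] := tangent_cst_section Ac scu tz.
apply: etrans (metric_fiber_conn x _ v Ac scu) _.
by rewrite (fiber_field_metric_eta hL x v Ac scu) mulr0.
Qed.

Lemma conn_cst_section_sum c u xi v : AM c -> dom (slit_chart c) u ->
  tangent SM u xi -> D u xi (cst_section c v) =
  \sum_j v ord0 j *: D u xi (cst_section c (delta_mx 0 j)).
Proof.
move=> Ac scu txi; have [su _] := scu; rewrite {1}(row_sum_delta v).
have c0 : D u xi (cst_section c 0) = 0.
  apply: (conn_near0 hD su txi).
  by apply: near_ptW (near_slit_dom Ac scu) => w scw; exact: cst_section0.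
elim/big_rec2: _ => [//|j x y _ E].
apply: etrans (conn_cst_section_lin hD _ _ _ Ac scu txi) _.
exact: (congr1 (+%R _) E).
Qed.

(** The derivative of the fibre coordinates gives back [v]; the other term is the
    Cartan tensor applied to the radial vector. *)
Lemma conn_gamma_eta u v : slit M u -> tangent AM u.1 v ->
  D u (gamma u v) (@eta R n M) = v.
Proof.
move=> su tv; have [c Ac scu] := slit_in_slit_chart su; have [_ cu] := scu.
have [x ->] := tangent_cst_section Ac scu tv.
rewrite (gamma_fiber_field x Ac scu); have tx := fiber_field_tangent x Ac scu.
rewrite (conn_frame hD Ac scu tx (eta_near su)) big_split /=.
have yE j : section_coord c (@eta R n M) j = fun w => fiber_coord c w ord0 j.
  by apply/funext => w; rewrite mxE.
under eq_bigr => j _ do rewrite yE (fiber_field_coord x j Ac scu).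
under [X in _ + X]eq_bigr => j _ do rewrite yE.
rewrite -(conn_cst_section_sum (fiber_coord c u) Ac scu tx).
rewrite (fiber_conn_fiber_coord x Ac scu) addr0.
exact/esym/cst_section_sum.
Qed.

Lemma horizontal_vertical u xi : slit M u -> tangent SM u xi ->
  xi = beta D u (rho u xi) + gamma u (D u xi (@eta R n M)).
Proof.
move=> su txi; have tr := rho_tangent su txi; have tb := beta_tangent rD su tr.
have td := tangent_sub gS txi tb.
have rd : rho u (xi - beta D u (rho u xi)) = 0 by rewrite rhoB (rho_beta rD su tr) subrr.
have [v tv dE] := rho_eq0 su td rd.
have xE : xi = 1 *: gamma u v + beta D u (rho u xi) by rewrite -dE scale1r subrK.
have : D u xi (@eta R n M) = v.
  rewrite {1}xE (conn_lin hD 1 su (gamma_tangent su tv) tb (eta_near su)).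
  by rewrite (conn_gamma_eta su tv) (conn_beta_eta rD su tr) addr0 scale1r.
by move=> ->; rewrite -dE addrC subrK.
Qed.

(** This is the vanishing of the torsion Q. *)
Lemma conn_beta_sym c v v' u : AM c -> dom (slit_chart c) u ->
  D u (beta D u (cst_section c v u)) (cst_section c v') =
  D u (beta D u (cst_section c v' u)) (cst_section c v).
Proof.
move=> Ac scu; have [su _] := scu.
apply/eqP; rewrite -subr_eq0; apply/eqP.
rewrite -(torsionQ_coord hD rD v v' Ac scu).
by case: hC => _ _ _ + _; apply=> //; exact: cst_section_near.
Qed.

End CartanConnection.
End Cartan.

(** * Concurrent sections *)

Section Concurrent.
Context {R : realType} {n : nat} {M : manifold R n}.

Notation vec := ((M -> R) -> R).
Notation TM := (M * vec)%type.
Notation vecT := ((TM -> R) -> R).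
Notation AM := (atlas M).
Notation SM := (slit_atlas M).
Implicit Types (c : chart R n M) (u w : TM) (xi : vecT) (s : TM -> vec).
Let gM := atlas_compatible M.
Let gS := slit_compatible M.

Variables (L : TM -> R) (nabla : connection M) (zeta : TM -> vec).
Hypotheses (hL : finsler L) (hnabla : cartan_connection L nabla).
Hypothesis hzeta : concurrent nabla zeta.
Notation g := (finsler_metric L).
Notation B := (fun w : TM => g w (zeta w) (@eta R n M w)).

Definition zeta_dual c v u := g u (cst_section c v u) (zeta u).
Definition zeta_norm u := g u (zeta u) (zeta u).

Let hD : linear_connection nabla. Proof. by case: hnabla. Qed.
Let rD : regular nabla. Proof. by case: hnabla. Qed.
Let mD : metric_connection L nabla. Proof. by case: hnabla. Qed.

Lemma zeta_near u : slit M u -> section_near u zeta.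
Proof. by case: hzeta => + _; apply. Qed.

Lemma zeta_tangent u : slit M u -> tangent AM u.1 (zeta u).
Proof. by move=> su; exact: section_near_tangent (zeta_near su). Qed.

(** The two conditions of concurrency, put together by the splitting
    [horizontal_vertical]. *)
Lemma conn_zeta u xi : slit M u -> tangent SM u xi -> nabla u xi zeta = - rho u xi.
Proof.
move=> su txi; have [_ hz] := hzeta.
have tr := rho_tangent su txi; have tb := beta_tangent rD su tr.
have tk := conn_tangent hD su txi (eta_near su).
have E := horizontal_vertical hL hnabla su txi.
have [hb _] := hz _ _ su tr; have [_ hg] := hz _ _ su tk.
rewrite {1}E -[X in X + _]scale1r (conn_lin hD 1 su tb (gamma_tangent su tk) (zeta_near su)).
by rewrite hb hg addr0 scale1r.
Qed.

Lemma zeta_dual_smooth c v u : AM c -> dom (slit_chart c) u ->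
  smooth_near SM u (zeta_dual c v).
Proof.
move=> Ac scu; have [su _] := scu.
exact: (metric_smooth hL su (cst_section_near v Ac scu) (zeta_near su)).
Qed.

(** Up to the factor -2 the square norm is a potential of the 1-form dual to
    [zeta]. *)
Lemma zeta_norm_derive u xi : slit M u -> tangent SM u xi ->
  xi (fun w => g w (zeta w) (zeta w)) = -2 * g u (rho u xi) (zeta u).
Proof.
move=> su txi; have tr := rho_tangent su txi; have tz := zeta_tangent su.
have double_opp (r : R) : - r - r = -2 * r by rewrite mulNr mulr_natl mulr2n opprD.
have zn := zeta_near su; have tN := tangentN gM tr.
rewrite (mD su txi zn zn) (conn_zeta su txi) (metricC hL su tz tN).
rewrite (metricNl hL su tr tz); exact: double_opp.
Qed.

(** The component [zeta_dual c v] is, up to a factor, the derivative of the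
    potential [g (zeta, zeta)] along a coordinate field of the base. The latter
    commutes with the fields along the fibres, and these kill the potential. *)
Lemma fiber_field_zeta_dual c x v u : AM c -> dom (slit_chart c) u ->
  fiber_field c x u (zeta_dual c v) = 0.
Proof.
move=> Ac scu; have [su _] := scu; have tx := fiber_field_tangent x Ac scu.
have zn := zeta_near su; have gs := metric_smooth hL su (cst_section_near v Ac scu) zn.
have fs := metric_smooth hL su zn zn.
have E : fiber_field c x u (fun w => -2 * zeta_dual c v w) = 0.
  transitivity (fiber_field c x u (fun w => coord_field c (row_mx v 0) w
      (fun w => g w (zeta w) (zeta w)))).
    apply: (tangent_dom_eq Ac scu tx) => w scw; have [sw _] := scw.
    rewrite (zeta_norm_derive sw (coord_field_tangent _ Ac scw)).
    by rewrite (rho_coord_field _ Ac scw) row_mxKl.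
  apply: etrans (coord_field_comm (row_mx 0 x) (row_mx v 0) Ac scu fs) _.
  have tc := coord_field_tangent (row_mx v 0) Ac scu.
  apply: etrans (tangent_cst gS 0 tc); apply: (tangent_dom_eq Ac scu tc) => w scw.
  have [sw _] := scw; have tw := fiber_field_tangent x Ac scw.
  rewrite -fiber_fieldE (zeta_norm_derive sw tw) (rho_fiber_field x Ac scw).
  by rewrite (metric0l hL sw (zeta_tangent sw)) mulr0.
rewrite (tangent_scale (-2) su tx gs) in E; move/eqP: E.
by rewrite mulf_eq0 oppr_eq0 pnatr_eq0 => /eqP.
Qed.

(** Compatibility with the metric turns the constancy of [zeta_dual] along the
    fibres into the orthogonality of the Cartan tensor to [zeta]. *)
Lemma zeta_fiber_conn c x v u : AM c -> dom (slit_chart c) u ->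
  g u (nabla u (fiber_field c x u) (cst_section c v)) (zeta u) = 0.
Proof.
move=> Ac scu; have [su cu] := scu; have tx := fiber_field_tangent x Ac scu.
have E := mD su tx (cst_section_near v Ac scu) (zeta_near su).
have t0 : tangent AM u.1 (cst_section c v u) := cst_section_tangent v Ac scu.
rewrite [LHS](fiber_field_zeta_dual x v Ac scu) (conn_zeta su tx) in E.
by rewrite (rho_fiber_field x Ac scu) oppr0 (metric0r hL su t0) addr0 in E.
Qed.

(** Total symmetry of the Cartan tensor moves [zeta] from the direction to the
    value, where [zeta_fiber_conn] applies. *)
Lemma conn_gamma_zeta c v u : AM c -> dom (slit_chart c) u ->
  nabla u (gamma u (zeta u)) (cst_section c v) = 0.
Proof.
move=> Ac scu; have [su cu] := scu.
have [z zE] := tangent_cst_section Ac scu (zeta_tangent su).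
rewrite zE (gamma_fiber_field z Ac scu).
apply: (metric_nondegenerate hL su (fiber_conn_tangent hnabla z v Ac scu)).
  exact: tangent0 Ac cu.
move=> X tX; rewrite (metric0l hL su tX).
have [v' ->] := tangent_cst_section Ac scu tX.
apply: etrans (metric_fiber_conn hL hnabla z v v' Ac scu) _.
rewrite (fiber_field_metric_sym hL z v v' Ac scu).
rewrite -(metric_fiber_conn hL hnabla v z v' Ac scu).
rewrite (fiber_conn_sym hnabla v z v' Ac scu) -zE.
exact: zeta_fiber_conn.
Qed.

Lemma B_smooth u : slit M u -> smooth_near SM u B.
Proof. by move=> su; exact: (metric_smooth hL su (zeta_near su) (eta_near su)). Qed.

(** The section [zeta] is parallel along the fibres and [eta] has derivative [v],
    so only the second factor of [B] contributes. *)
Lemma fiber_field_B c v u : AM c -> dom (slit_chart c) u ->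
  fiber_field c v u B = zeta_dual c v u.
Proof.
move=> Ac scu; have [su cu] := scu; have tv := fiber_field_tangent v Ac scu.
have tz := zeta_tangent su; have tc := cst_section_tangent v Ac scu.
have te := section_near_tangent (eta_near su).
rewrite (mD su tv (zeta_near su) (eta_near su)) (conn_zeta su tv).
rewrite (rho_fiber_field v Ac scu) oppr0 (metric0l hL su te) add0r -(gamma_fiber_field v Ac scu).
by rewrite (conn_gamma_eta hL hnabla su tc) (metricC hL su tz tc).
Qed.

End Concurrent.

(** * Algebra of the uniqueness of Cartan connections *)

(** Here [s] stands for the difference of two connections compatible with the
    same metric, lowered to a trilinear form, [y] for the fundamental vector,
    and [p] for the contribution of the Cartan tensor, due to the difference of
    the horizontal distributions. Contracting once or twice with [y] removes
    [p], which shows that [s] vanishes on (y, y) and then on all (v, y).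
    Therefore [p] is zero, and [s] is skew in its last two arguments and
    symmetric in the first two, which forces it to vanish. *)
Lemma skew_defect_eq0 (R : realFieldType) (T : Type) (y : T) (s p : T -> T -> T -> R) :
  (forall v w z, s v w z = - s v z w) ->
  (forall v w z, s v w z - p v w z = s w v z - p w v z) ->
  (forall v z, p v y z = 0) -> (forall v w, p v w y = 0) ->
  (forall v, (forall z, s v y z = 0) -> forall w z, p v w z = 0) ->
  forall v w z, s v w z = 0.
Proof.
move=> skew sym py pyr p0.
have opp0 (r : R) : r = - r -> r = 0.
  by move=> /eqP; rewrite -addr_eq0 -mulr2n mulrn_eq0 => /eqP.
have symy v w : s v w y = s w v y by have := sym v w y; rewrite !pyr !subr0.
have syy z : s y y z = 0.
  by rewrite skew symy (opp0 (s z y y)) ?oppr0// -skew.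
have pY : forall w z, p y w z = 0 by apply: p0.
have svy v z : s v y z = s y v z by have := sym v y z; rewrite py pY !subr0.
have sy0 v z : s v y z = 0.
  apply: opp0; rewrite [LHS]skew [s v z y]symy -skew.
  by rewrite (svy z v) skew (svy v z).
have pE v w z : p v w z = 0 by apply: p0.
have s12 v w z : s v w z = s w v z by have := sym v w z; rewrite !pE !subr0.
move=> v w z; apply: opp0.
by rewrite {1}s12 {1}skew {1}s12 {1}skew opprK {1}s12 {1}skew.
Qed.

(** * The energy change *)

#[local] Opaque zeta_dual.

Section EnergyChange.
Context {R : realType} {n : nat} {M : manifold R n}.

Notation vec := ((M -> R) -> R).
Notation TM := (M * vec)%type.
Notation vecT := ((TM -> R) -> R).
Notation AM := (atlas M).
Notation SM := (slit_atlas M).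
Implicit Types (c : chart R n M) (u w : TM) (xi : vecT) (s : TM -> vec).
Let gM := atlas_compatible M.
Let gS := slit_compatible M.

Variables (L Lt : TM -> R) (nabla nablat : connection M) (zeta : TM -> vec).
Hypotheses (hL : finsler L) (hnabla : cartan_connection L nabla).
Hypothesis hzeta : concurrent nabla zeta.
Hypothesis hLt : finsler Lt.
Hypothesis hchange : forall u, slit M u ->
  Lt u ^+ 2 = L u ^+ 2 + finsler_metric L u (zeta u) (eta u) ^+ 2.
Hypothesis hnablat : cartan_connection Lt nablat.
Notation g := (finsler_metric L).
Notation gt := (finsler_metric Lt).
Notation B := (fun w : TM => g w (zeta w) (@eta R n M w)).

Let hD : linear_connection nabla. Proof. by case: hnabla. Qed.
Let rD : regular nabla. Proof. by case: hnabla. Qed.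
Let mD : metric_connection L nabla. Proof. by case: hnabla. Qed.
Let hDt : linear_connection nablat. Proof. by case: hnablat. Qed.
Let rDt : regular nablat. Proof. by case: hnablat. Qed.
Let mDt : metric_connection Lt nablat. Proof. by case: hnablat. Qed.

Local Notation zdual := (zeta_dual L zeta).

Lemma changed_energy_derive c v u : AM c -> dom (slit_chart c) u ->
  fiber_field c v u (fun w => Lt w ^+ 2) =
  fiber_field c v u (fun w => L w ^+ 2) + 2 * (B u * zdual c v u).
Proof.
move=> Ac scu; have [su _] := scu; have tv := fiber_field_tangent v Ac scu.
have dbl (r : R) : r + r = 2 * r by rewrite mulr_natl mulr2n.
have Bs := B_smooth hL hzeta su.
transitivity (fiber_field c v u (fun w => L w ^+ 2 + B w * B w)).
  by apply: (tangent_dom_eq Ac scu tv) => w [sw _]; rewrite -expr2 hchange.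
apply: etrans (tangentD gS tv (energy_smooth hL su) (smooth_nearM gS Bs Bs)) _.
congr (_ + _); apply: etrans (tangentM gS tv Bs Bs) _.
have EB := fiber_field_B hL hnabla hzeta v Ac scu.
apply: etrans (congr1 (fun r => B u * r + B u * r) EB) _.
exact: dbl.
Qed.

(** The function [B] has second derivatives zero along the fibres, so the Hessian
    of [B ^+ 2] is twice the square of its differential. *)
Lemma changed_metric_cst c v v' u : AM c -> dom (slit_chart c) u ->
  gt u (cst_section c v u) (cst_section c v' u) =
  g u (cst_section c v u) (cst_section c v' u) + zdual c v u * zdual c v' u.
Proof.
move=> Ac scu; have [su _] := scu; have tv := fiber_field_tangent v Ac scu.
have Bs := B_smooth hL hzeta su; have Zs := zeta_dual_smooth hL hzeta v' Ac scu.
have Ls := fiber_field_smooth v' Ac scu (energy_smooth hL su).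
have drop0 (a b d : R) : a * 0 + b * d = d * b by rewrite mulr0 add0r mulrC.
have add_half (a b : R) : 2^-1 * (a + 2 * b) = 2^-1 * a + b.
  by rewrite mulrDr mulKf// pnatr_eq0.
have Ms := smooth_nearM gS Bs Zs.
have c2 := smooth_near_cst 2 (slit_atlasE Ac) scu.
apply: etrans (finsler_metricE hLt v v' Ac scu) _.
have E : fiber_field c v u (fun w => fiber_field c v' w (fun w => Lt w ^+ 2)) =
    fiber_field c v u (fun w => fiber_field c v' w (fun w => L w ^+ 2)) +
    2 * (zdual c v u * zdual c v' u).
  transitivity (fiber_field c v u (fun w => fiber_field c v' w (fun w => L w ^+ 2)
      + 2 * (B w * zdual c v' w))).
    by apply: (tangent_dom_eq Ac scu tv) => w scw; exact: changed_energy_derive.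
  apply: etrans (tangentD gS tv Ls (smooth_nearM gS c2 Ms)) _; congr (_ + _).
  apply: etrans (tangent_scale 2 su tv Ms) _; congr (_ * _).
  apply: etrans (tangentM gS tv Bs Zs) _.
  have EZ := fiber_field_zeta_dual hL hnabla hzeta v v' Ac scu.
  have EB := fiber_field_B hL hnabla hzeta v Ac scu.
  apply: etrans (congr2 (fun a b => B u * a + zdual c v' u * b) EZ EB) _.
  exact: drop0.
apply: etrans (congr1 ( *%R 2^-1) E) _; apply: etrans (add_half _ _) _.
by rewrite -(finsler_metricE hL v v' Ac scu).
Qed.

Lemma changed_metricE u X Y : slit M u -> tangent AM u.1 X -> tangent AM u.1 Y ->
  gt u X Y = g u X Y + g u X (zeta u) * g u Y (zeta u).
Proof.
move=> su; have [c Ac scu] := slit_in_slit_chart su.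
move=> /(tangent_cst_section Ac scu)[a ->] /(tangent_cst_section Ac scu)[b ->].
exact: changed_metric_cst.
Qed.

(** The metric changes by a square of components that are constant along the
    fibres. *)
Lemma fiber_field_changed_metric c x v v' u : AM c -> dom (slit_chart c) u ->
  fiber_field c x u (fun w => gt w (cst_section c v w) (cst_section c v' w)) =
  fiber_field c x u (fun w => g w (cst_section c v w) (cst_section c v' w)).
Proof.
move=> Ac scu; have [su _] := scu; have tx := fiber_field_tangent x Ac scu.
have zs z := zeta_dual_smooth hL hzeta z Ac scu.
transitivity (fiber_field c x u (fun w => g w (cst_section c v w) (cst_section c v' w)
    + zdual c v w * zdual c v' w)).
  by apply: (tangent_dom_eq Ac scu tx) => w scw; exact: changed_metric_cst.
have gs := metric_cst_smooth hL v v' Ac scu.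
apply: etrans (tangentD gS tx gs (smooth_nearM gS (zs v) (zs v'))) _.
have z0 z : fiber_field c x u (zdual c z) = 0.
  exact: (fiber_field_zeta_dual hL hnabla hzeta x z Ac scu).
have drop0 (a b d : R) : a + (b * 0 + d * 0) = a by rewrite !mulr0 !addr0.
rewrite (tangentM gS tx (zs v) (zs v')).
apply: etrans (congr2 (fun a b => _ + (zdual c v u * a + zdual c v' u * b))
  (z0 v') (z0 v)) _.
exact: drop0.
Qed.

(** The vertical part of each connection is determined by the fibre derivative of
    its metric. Both metrics give the same value on it, as it is orthogonal to
    [zeta]. *)
Lemma changed_fiber_conn c x v u : AM c -> dom (slit_chart c) u ->
  nablat u (fiber_field c x u) (cst_section c v) =
  nabla u (fiber_field c x u) (cst_section c v).
Proof.
move=> Ac scu; have [su _] := scu.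
have t1 := fiber_conn_tangent hnablat x v Ac scu.
have t2 := fiber_conn_tangent hnabla x v Ac scu.
apply: (metric_nondegenerate hLt su t1 t2) => X tX.
have [v' ->] := tangent_cst_section Ac scu tX.
apply: etrans (metric_fiber_conn hLt hnablat x v v' Ac scu) _.
rewrite (fiber_field_changed_metric x v v' Ac scu).
rewrite -(metric_fiber_conn hL hnabla x v v' Ac scu).
rewrite (changed_metricE su t2 (cst_section_tangent v' Ac scu)).
by rewrite (zeta_fiber_conn hL hnabla hzeta x v Ac scu) mul0r addr0.
Qed.

Lemma changed_conn_gamma u X s : slit M u -> tangent AM u.1 X -> section_near u s ->
  nablat u (gamma u X) s = nabla u (gamma u X) s.
Proof.
move=> su tX us; have [c Ac scu] := slit_in_slit_chart su.
have tg := gamma_tangent su tX; have ts := section_near_tangent us.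
have [v sE] := tangent_cst_section Ac scu ts.
apply/eqP; rewrite -subr_eq0; apply/eqP.
rewrite (conn_sub_tensorial hDt hD su tg us (cst_section_near v Ac scu) sE).
have [x ->] := tangent_cst_section Ac scu tX.
by rewrite (gamma_fiber_field x Ac scu) changed_fiber_conn// subrr.
Qed.

Lemma zeta_norm_gt0 u : slit M u -> 0 < 1 + zeta_norm L zeta u.
Proof.
by move=> su; rewrite ltr_wpDr// (metric_ge0 hL su)//; exact: (zeta_tangent hzeta su).
Qed.

Lemma changed_metric_zeta u X : slit M u -> tangent AM u.1 X ->
  gt u (zeta u) X = (1 + zeta_norm L zeta u) * g u X (zeta u).
Proof.
move=> su tX; have tz := zeta_tangent hzeta su.
rewrite (changed_metricE su tz tX) (metricC hL su tz tX) mulrDl mul1r.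
by [].
Qed.

Section Defect.
Variables (c : chart R n M) (u : TM).
Hypotheses (Ac : AM c) (scu : dom (slit_chart c) u).
Let su : slit M u. Proof. by case: scu. Qed.

Notation e := (cst_section c).
Notation y := (fiber_coord c u).
Notation r a b := (g u (e a u) (e b u) / (1 + zeta_norm L zeta u)).

Let te a : tangent AM u.1 (e a u) := cst_section_tangent a Ac scu.
Let ne a : section_near u (e a) := cst_section_near a Ac scu.
Let tz : tangent AM u.1 (zeta u) := zeta_tangent hzeta su.

Definition hlift a := beta nabla u (e a u).

Let tl a : tangent SM u (hlift a) := beta_tangent rD su (te a).

(** The gap in the relation to be proved, on constant sections; the directions are
    horizontal for [nabla]. *)
Definition defect a b : vec :=
  nablat u (hlift a) (e b) - nabla u (hlift a) (e b) + r a b *: zeta u.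

Let tn a b : tangent AM u.1 (nabla u (hlift a) (e b)) := conn_tangent hD su (tl a) (ne b).
Let tnt a b : tangent AM u.1 (nablat u (hlift a) (e b)) := conn_tangent hDt su (tl a) (ne b).

Lemma defect_tangent a b : tangent AM u.1 (defect a b).
Proof. exact: (tangent_add gM (tangent_sub gM (tnt a b) (tn a b)) (tangentZ gM _ tz)). Qed.

Lemma defect_metric a b d : gt u (defect a b) (e d u) =
  gt u (nablat u (hlift a) (e b)) (e d u) - gt u (nabla u (hlift a) (e b)) (e d u) +
  g u (e a u) (e b u) * zdual c d u.
Proof.
have k0 : 1 + zeta_norm L zeta u != 0 by rewrite gt_eqF// zeta_norm_gt0.
apply: etrans (metric_comb hLt _ su (tnt a b) (tn a b) tz (te d)) _.
by rewrite (changed_metric_zeta su (te d)) mulrA divfK.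
Qed.

Lemma hlift_zeta_dual a b : hlift a (zdual c b) =
  g u (nabla u (hlift a) (e b)) (zeta u) - g u (e a u) (e b u).
Proof.
apply: etrans (mD su (tl a) (ne b) (zeta_near hzeta su)) _; congr (_ + _).
rewrite (conn_zeta hL hnabla hzeta su (tl a)) (rho_beta rD su (te a)).
apply: etrans (metricC hL su (te b) (tangentN gM (te a))) _.
exact: (metricNl hL su (te a) (te b)).
Qed.

(** The correction [r a b *: zeta u] makes [nabla] compatible with the new metric,
    so the defect is the difference of two metric connections. *)
Lemma defect_skew a b d : gt u (defect a b) (e d u) = - gt u (defect a d) (e b u).
Proof.
have arith (s1 s2 m1 m2 n1 n2 g1 g2 zb zd pd pb gad gab ld lb : R) :
    s1 = m1 - n1 + gab * zd -> s2 = m2 - n2 + gad * zb ->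
    n1 = g1 + pb * zd -> n2 = g2 + pd * zb -> ld = pd - gad -> lb = pb - gab ->
    m1 + m2 = (g1 + g2) + (zb * ld + zd * lb) -> s1 = - s2.
  by move=> *; subst; lra.
have C1 : gt u (nabla u (hlift a) (e b)) (e d u) = g u (nabla u (hlift a) (e b)) (e d u) +
    g u (nabla u (hlift a) (e b)) (zeta u) * zdual c d u.
  exact: changed_metricE su (tn a b) (te d).
have C2 : gt u (nabla u (hlift a) (e d)) (e b u) = g u (nabla u (hlift a) (e d)) (e b u) +
    g u (nabla u (hlift a) (e d)) (zeta u) * zdual c b u.
  exact: changed_metricE su (tn a d) (te b).
have Et := mDt su (tl a) (ne b) (ne d); have E := mD su (tl a) (ne b) (ne d).
have St := metricC hLt su (tnt a d) (te b); have S := metricC hL su (te b) (tn a d).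
have zs x := zeta_dual_smooth hL hzeta x Ac scu.
have gs := metric_cst_smooth hL b d Ac scu.
have Ed : hlift a (fun w => gt w (e b w) (e d w)) =
    hlift a (fun w => g w (e b w) (e d w) + zdual c b w * zdual c d w).
  by apply: (tangent_dom_eq Ac scu (tl a)) => x scx; exact: changed_metric_cst.
have key : gt u (nablat u (hlift a) (e b)) (e d u) + gt u (nablat u (hlift a) (e d)) (e b u) =
    (g u (nabla u (hlift a) (e b)) (e d u) + g u (nabla u (hlift a) (e d)) (e b u)) +
    (zdual c b u * hlift a (zdual c d) + zdual c d u * hlift a (zdual c b)).
  apply: etrans (congr1 (+%R _) St) _; apply: etrans (esym Et) _; apply: etrans Ed _.
  apply: etrans (tangentD gS (tl a) gs (smooth_nearM gS (zs b) (zs d))) _.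
  apply: congr2; first exact: etrans E (congr1 (+%R _) S).
  exact: (tangentM gS (tl a) (zs b) (zs d)).
exact: (arith _ _ _ _ _ _ _ _ _ _ _ _ _ _ _ _ (defect_metric a b d)
  (defect_metric a d b) C1 C2 (hlift_zeta_dual a d) (hlift_zeta_dual a b) key).
Qed.

Let tbt a : tangent SM u (beta nablat u (e a u)) := beta_tangent rDt su (te a).

(** Two vectors with the same projection differ by a vertical one, on which the
    connections agree. *)
Lemma conn_sub_hlift a xi s : tangent SM u xi -> rho u xi = e a u -> section_near u s ->
  nablat u xi s - nabla u xi s = nablat u (hlift a) s - nabla u (hlift a) s.
Proof.
move=> txi rxi us; have E := horizontal_vertical hL hnabla su txi.
have tk := conn_tangent hD su txi (eta_near su).
rewrite rxi -[X in X + _]scale1r in E; have tg := gamma_tangent su tk.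
rewrite {1 2}E (conn_lin hDt 1 su (tl a) tg us) (conn_lin hD 1 su (tl a) tg us).
rewrite (changed_conn_gamma su tk us) !scale1r.
by rewrite opprD addrACA subrr addr0.
Qed.

Let etaE : @eta R n M u = e y u.
Proof. by case: (scu) => s1 cu; rewrite cst_sectionE; exact: slit_vec_coordE. Qed.

(** By [horizontal_vertical] the vertical part for [nabla] is the covariant
    derivative of the fundamental section; it is the opposite of a difference
    of the two connections, since the derivative for [nablat] vanishes. *)
Lemma changed_beta a : beta nablat u (e a u) =
  hlift a + gamma u (-1 *: defect a y + r a y *: zeta u).
Proof.
have E := horizontal_vertical hL hnabla su (tbt a).
rewrite (rho_beta rDt su (te a)) in E.
have T := conn_sub_tensorial hDt hD su (tbt a) (eta_near su) (ne y) etaE.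
rewrite (conn_beta_eta rDt su (te a)) sub0r in T.
rewrite (conn_sub_hlift (tbt a) (rho_beta rDt su (te a)) (ne y)) in T.
rewrite {1}E /hlift; congr (_ + gamma u _).
rewrite /defect -T scalerDr !scaleN1r opprK -addrA addNr addr0.
by [].
Qed.

Lemma conn_changed_beta a b : nablat u (beta nablat u (e a u)) (e b) =
  nabla u (hlift a) (e b) + (defect a b - r a b *: zeta u)
  - nabla u (gamma u (defect a y)) (e b).
Proof.
have cancel_terms (X Y C Z : vec) (k : R) :
    X + (-1 *: C + k *: 0) = Y + ((X - Y + Z) - Z) - C.
  by rewrite scaler0 addr0 scaleN1r addrK [Y + _]addrC subrK.
have td := defect_tangent a y; have tzr := tangentZ gM (r a y) tz.
have tk := tangent_lin gM (-1) td tzr.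
have E := changed_beta a; rewrite -[X in X + _]scale1r in E.
rewrite E (conn_lin hDt 1 su (tl a) (gamma_tangent su tk) (ne b)) scale1r.
rewrite (changed_conn_gamma su tk (ne b)) (conn_gamma_lin hD (-1) su td tzr (ne b)).
rewrite (conn_gammaZ hD _ su tz (ne b)) (conn_gamma_zeta hL hnabla hzeta b Ac scu).
exact: cancel_terms.
Qed.

(** Difference of the two conditions Q = 0, each taken with its own horizontal
    map. *)
Lemma defect_sym a b :
  defect a b - nabla u (gamma u (defect a y)) (e b) =
  defect b a - nabla u (gamma u (defect b y)) (e a).
Proof.
have cancel_common (X X' Z Z' d1 d2 c1 c2 : vec) : X = X' -> Z = Z' ->
    X + (d1 - Z) - c1 = X' + (d2 - Z') - c2 -> d1 - c1 = d2 - c2.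
  move=> -> ->; rewrite -!addrA => /addrI.
  by rewrite addrCA [RHS]addrCA => /addrI.
have H := etrans (esym (conn_changed_beta a b))
  (etrans (conn_beta_sym hnablat a b Ac scu) (conn_changed_beta b a)).
have H' : nabla u (hlift a) (e b) = nabla u (hlift b) (e a).
  exact: (conn_beta_sym hnabla a b Ac scu).
have Hr : r a b *: zeta u = r b a *: zeta u by rewrite (metricC hL su (te a) (te b)).
exact: cancel_common H' Hr H.
Qed.

Lemma defect_eq0 a b : defect a b = 0.
Proof.
have [_ cu] := scu; have t0 : tangent AM u.1 0 := tangent0 gM Ac cu.
have tC a1 X : tangent AM u.1 X -> tangent AM u.1 (nabla u (gamma u X) (e a1)).
  by move=> tX; exact: (conn_tangent hD su (gamma_tangent su tX) (ne a1)).
have tpC a1 b1 := tC b1 _ (defect_tangent a1 y).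
have vanish X : tangent AM u.1 X -> (forall d, gt u X (e d u) = 0) -> X = 0.
  move=> tX H; apply: (metric_nondegenerate hLt su tX t0) => Y tY.
  have [d ->] := tangent_cst_section Ac scu tY.
  by rewrite (metric0l hLt su (te d)) H.
pose p a1 b1 d1 := gt u (nabla u (gamma u (defect a1 y)) (e b1)) (e d1 u).
have fC a1 d1 : exists d1', nabla u (gamma u (defect a1 y)) (e d1) =
    nabla u (fiber_field c d1' u) (e d1).
  have [d1' ->] := tangent_cst_section Ac scu (defect_tangent a1 y).
  by exists d1'; rewrite (gamma_fiber_field d1' Ac scu).
have Cy a1 : nabla u (gamma u (defect a1 y)) (e y) = 0.
  by have [d1' ->] := fC a1 y; exact: (fiber_conn_fiber_coord hL hnabla d1' Ac scu).
apply: (vanish _ (defect_tangent a b)).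
apply: (@skew_defect_eq0 _ _ y (fun a1 b1 d1 => gt u (defect a1 b1) (e d1 u)) p).
- exact: defect_skew.
- move=> a1 b1 d1.
  apply: etrans (esym (metricBl hLt su (defect_tangent a1 b1) (tpC a1 b1) (te d1))) _.
  apply: etrans _ (metricBl hLt su (defect_tangent b1 a1) (tpC b1 a1) (te d1)).
  exact: (congr1 (fun X => gt u X (e d1 u)) (defect_sym a1 b1)).
- by move=> a1 d1; rewrite /p Cy (metric0l hLt su (te d1)).
- move=> a1 b1; rewrite /p; have t1 := tpC a1 b1; have [d1' E] := fC a1 b1.
  rewrite {}E in t1 *; apply: etrans (changed_metricE su t1 (te y)) _.
  rewrite (zeta_fiber_conn hL hnabla hzeta d1' b1 Ac scu) mul0r addr0.
  apply: etrans (fiber_conn_sym hnabla d1' b1 y Ac scu) _.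
  by rewrite (fiber_conn_fiber_coord hL hnabla d1' Ac scu) (metric0l hL su (te b1)).
move=> a1 H b1 d1; rewrite /p (vanish _ (defect_tangent a1 y) H).
by rewrite (conn_gamma0 hD su (ne b1)) (metric0l hLt su (te d1)).
Qed.

End Defect.

(** By tensoriality the relation reduces to constant sections, and by
    [conn_sub_hlift] to horizontal directions. *)
Lemma changed_connE u xi s : slit M u -> tangent SM u xi -> section_near u s ->
  nablat u xi s = nabla u xi s -
  (g u (rho u xi) (s u) / (1 + zeta_norm L zeta u)) *: zeta u.
Proof.
move=> su txi us; have [c Ac scu] := slit_in_slit_chart su.
have tr := rho_tangent su txi; have ts := section_near_tangent us.
have [a rE] := tangent_cst_section Ac scu tr; have [b sE] := tangent_cst_section Ac scu ts.
have T := conn_sub_tensorial hDt hD su txi us (cst_section_near b Ac scu) sE.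
rewrite (conn_sub_hlift Ac scu txi rE (cst_section_near b Ac scu)) in T.
have solve (X Y Z : vec) : X - Y + Z = 0 -> X = Y - Z.
  by move=> E; apply/eqP; rewrite -subr_eq0 opprB addrA addrAC E.
have D0 := defect_eq0 Ac scu a b; rewrite /defect -T in D0.
by rewrite rE sE; exact: solve.
Qed.

End EnergyChange.

Theorem theorem5p3 (R : realType) (n : nat) (M : manifold R n)
    (L Lt : M * ((M -> R) -> R) -> R)
    (nabla nablat : connection M)
    (zeta : M * ((M -> R) -> R) -> (M -> R) -> R)
    (hL : finsler L)
    (hnabla : cartan_connection L nabla)
    (hzeta : concurrent nabla zeta)
    (hLt : finsler Lt)
    (hchange : forall u, slit M u ->
       Lt u ^+ 2 = L u ^+ 2 + finsler_metric L u (zeta u) (eta u) ^+ 2)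
    (hnablat : cartan_connection Lt nablat) :
  let g := finsler_metric L in
  let p2 := fun u => g u (zeta u) (zeta u) in
  let U := fun (X Y : M * ((M -> R) -> R) -> (M -> R) -> R) u =>
    (g u (X u) (Y u) / (1 + p2 u)) *: zeta u
    - (g u (X u) (eta u) / (1 + p2 u)) *: nabla u (gamma u (zeta u)) Y in
  [/\ forall X Y, slit_vfield X -> slit_vfield Y -> forall u, slit M u ->
        nablat u (X u) (fun w => rho w (Y w)) =
        nabla u (X u) (fun w => rho w (Y w))
        - (g u (rho u (X u)) (rho u (Y u)) / (1 + p2 u)) *: zeta u,
      forall X Y, pi_vfield X -> pi_vfield Y -> forall u, slit M u ->
        nablat u (gamma u (X u)) Y = nabla u (gamma u (X u)) Y &
      forall X Y, pi_vfield X -> pi_vfield Y -> forall u, slit M u ->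
        nablat u (beta nablat u (X u)) Y =
        nabla u (beta nabla u (X u)) Y - U X Y u].
Proof.
move=> g p2 U.
have main := changed_connE hL hnabla hzeta hLt hchange hnablat.
have hD : linear_connection nabla by case: hnabla.
have rD : regular nabla by case: hnabla.
have rDt : regular nablat by case: hnablat.
split=> X Y hX hY u su.
- have tX : tangent (slit_atlas M) u (X u) := vfield_near_tangent (hX u su).
  exact: (main u _ _ su tX (rho_section_near su (hY u su))).
- apply: (changed_conn_gamma hL hnabla hzeta hLt hchange hnablat su _ (hY u su)).
  exact: section_near_tangent (hX u su).
have tX := section_near_tangent (hX u su); have nY := hY u su.
have tz := zeta_tangent hzeta su.
have tb := beta_tangent rDt su tX; have tl := beta_tangent rD su tX.
pose q := g u (X u) (eta u) / (1 + p2 u).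
have E := horizontal_vertical hL hnabla su tb.
have K : nabla u (beta nablat u (X u)) (@eta R n M) = q *: zeta u.
  have := main u _ _ su tb (eta_near su).
  rewrite (conn_beta_eta rDt su tX) (rho_beta rDt su tX) => /esym/eqP.
  by rewrite subr_eq0 => /eqP.
rewrite (rho_beta rDt su tX) K -[X in X + _]scale1r in E.
have tqz := tangentZ (atlas_compatible M) q tz.
rewrite (main u _ _ su tb nY) (rho_beta rDt su tX) {1}E.
rewrite (conn_lin hD 1 su tl (gamma_tangent su tqz) nY) scale1r.
rewrite (conn_gammaZ hD q su tz nY).
have regroup (V W Z : (M -> R) -> R) : V + W - Z = V - (Z - W) by rewrite opprB addrA.
exact: regroup.
Qed.
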